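(* The map $\varphi$, restricted to $\mathcal{H}_0$, is a one-to-one and onto mapping $\varphi:\mathcal{H}_0\to\mathcal{T}$, and its inverse $\varphi^{-1}:\mathcal{T}\to\mathcal{H}_0$ is the map $\varphi'$.
   Context: Identically distributed random variables are regarded as equal. Inverse distribution functions are left-continuous: $F^{-1}(u)=\inf\{x:F(x)\ge u\}$, $0<u<1$. Put $L(u)=-\log(1-u)$, $0<u<1$. A function $H:(0,\infty)\to\mathbb{R}$ belongs to $\mathcal{H}^*$ if it is non-constant, non-decreasing, left-continuous and $\int_0^\infty y^m e^{-y}|H(y)|\,dy<\infty$ for $m=0,1,2,\ldots$. $\mathcal{H}_0$ is the set of $H\in\mathcal{H}^*$ with $\int_0^\infty e^{-y}H(y)\,dy=0$ and $\int_0^\infty y e^{-y}H(y)\,dy=1$. A random variable $X$ is said to belong to $\mathcal{H}^*$ (resp. $\mathcal{H}_0$) if its inverse distribution function $G$ can be written as $G(u)=H(-\log(1-u))$, $0<u<1$, with $H\in\mathcal{H}^*$ (resp. $H\in\mathcal{H}_0$). $\mathcal{T}$ is the set of all random variables $T$ with $\Pr(T>0)=1$ and finite moments of every order. Map $\varphi$: for $X\in\mathcal{H}^*$ with distribution function $F$, $\varphi(X):=L(F(V))$, where $V$ is a random variable with Lebesgue density $f_V(x)=(1-F(x))L(F(x))\big/\int_{\mathbb{R}}(1-F(y))L(F(y))\,dy$, $x\in\mathbb{R}$, with the convention $(1-F(x))L(F(x))=0$ if $F(x)\in\{0,1\}$. Map $\varphi'$: for $T\in\mathcal{T}$ with distribution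 function $F_T$, $\varphi'(T)$ is the random variable whose inverse distribution function $G_0$ is given by $G_0(1-e^{-y})=H_0(y)$, $y>0$, where $$H_0(y)=\frac{e^y}{y}F_T(y-)-\int_1^y\frac{x-1}{x^2}e^xF_T(x)\,dx-c_T,\qquad y>0,$$ $F_T(y-)=\Pr(T<y)$, $\int_1^y=-\int_y^1$ if $0<y<1$, and $c_T$ is the unique constant (depending only on $T$) for which $\int_0^\infty e^{-y}H_0(y)\,dy=0$. *)

(* Defs.v *)
From HB Require Import structures.
From mathcomp Require Import all_boot all_order all_algebra.
From mathcomp Require Import all_classical all_reals all_analysis.

Set Implicit Arguments.
Unset Strict Implicit.
Unset Printing Implicit Defensive.

Import Order.TTheory GRing.Theory Num.Theory.
Import numFieldNormedType.Exports.

Local Open Scope classical_set_scope.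
Local Open Scope ring_scope.

(* A real random variable together with the probability space carrying it. *)
Record randvar (R : realType) := Randvar {
  rv_disp : measure_display;
  rv_space : measurableType rv_disp;
  rv_prob : probability rv_space R;
  rv_fun : {RV rv_prob >-> R} }.

Definition Pr (R : realType) (X : randvar R) (A : set R) : \bar R :=
  distribution (rv_prob X) (rv_fun X) A.

Definition eq_dist (R : realType) (X Y : randvar R) : Prop :=
  forall A : set R, measurable A -> Pr X A = Pr Y A.

Definition df (R : realType) (X : randvar R) (x : R) : R :=
  fine (cdf (rv_fun X) x).

(* F(x-) *)
Definition df_left (R : realType) (X : randvar R) (x : R) : R :=
  fine (Pr X `]-oo, x[).

(* Meaningful for 0 < u < 1 only, where the set is nonempty and bounded below. *)
Definition inv_df (R : realType) (X : randvar R) (u : R) : R :=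
  inf [set x | u <= df X x].

(* Since ln 0 = 0 in the library, the value at the boundary point u = 1 is 0. *)
Definition L (R : realType) (u : R) : R := - ln (1 - u).

(* Only the values of H on ]0, +oo[ matter. *)
Definition Hstar_fun (R : realType) (H : R -> R) : Prop :=
  [/\ exists x y : R, [/\ 0 < x, 0 < y & H x != H y],
      {in `]0, +oo[ &, nondecreasing_fun H},
      forall y : R, 0 < y -> H x @[x --> y^'-] --> H y
    & forall m : nat,
        (\int[lebesgue_measure]_(y in `]0%R, +oo[)
            (y ^+ m * expR (- y) * `|H y|)%:E < +oo)%E].

Definition H0_fun (R : realType) (H : R -> R) : Prop :=
  [/\ Hstar_fun H,
      (\int[lebesgue_measure]_(y in `]0%R, +oo[) (expR (- y) * H y)%:E = 0)%E
    & (\int[lebesgue_measure]_(y in `]0%R, +oo[)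
          (y * expR (- y) * H y)%:E = 1)%E].

Definition in_H0 (R : realType) (X : randvar R) : Prop :=
  exists2 H : R -> R, H0_fun H &
    forall u : R, 0 < u < 1 -> inv_df X u = H (L u).

Definition in_T (R : realType) (T : randvar R) : Prop :=
  Pr T `]0, +oo[ = 1%E /\
  forall n : nat,
    (rv_prob T).-integrable setT (fun w => (rv_fun T w ^+ n)%:E).

(* Equal to 0 when F(x) is 0 or 1, as ln 1 = 0 and 1 - F(x) = 0 respectively. *)
Definition phi_weight (R : realType) (X : randvar R) (x : R) : R :=
  (1 - df X x) * L (df X x).

Definition phi_density (R : realType) (X : randvar R) (x : R) : R :=
  phi_weight X x / \int[lebesgue_measure]_(y in setT) phi_weight X y.

Definition has_density (R : realType) (V : randvar R) (f : R -> R) : Prop :=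
  forall A : set R, measurable A ->
    Pr V A = (\int[lebesgue_measure]_(x in A) (f x)%:E)%E.

(* T = phi(X), that is, T is distributed as L(F(V)). *)
Definition is_phi (R : realType) (X T : randvar R) : Prop :=
  exists2 V : randvar R, has_density V (phi_density X) &
    forall A : set R, measurable A ->
      Pr T A = rv_prob V [set w | A (L (df X (rv_fun V w)))].

Definition oriented_integral (R : realType) (a b : R) (f : R -> R) : R :=
  if a <= b then \int[lebesgue_measure]_(x in `[a, b]) f x
  else - \int[lebesgue_measure]_(x in `[b, a]) f x.

Definition phi'_fun (R : realType) (T : randvar R) (c y : R) : R :=
  expR y / y * df_left T y
  - oriented_integral 1 y (fun x => (x - 1) / x ^+ 2 * expR x * df T x)
  - c.

Definition phi'_centering (R : realType) (T : randvar R) (c : R) : Prop :=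
  (\int[lebesgue_measure]_(y in `]0%R, +oo[)
      (expR (- y) * phi'_fun T c y)%:E = 0)%E.

(* X = phi'(T) *)
Definition is_phi' (R : realType) (T X : randvar R) : Prop :=
  exists c : R, [/\ phi'_centering T c,
    forall c' : R, phi'_centering T c' -> c' = c
  & forall y : R, 0 < y -> inv_df X (1 - expR (- y)) = phi'_fun T c y].

(* f is the graph of a map from A to B, where identically distributed random
   variables are identified. *)
Definition is_map (R : realType) (A B : randvar R -> Prop)
    (f : randvar R -> randvar R -> Prop) : Prop :=
  (forall X, A X -> exists2 Y, B Y & f X Y) /\
  (forall X X' Y Y', A X -> f X Y -> eq_dist X X' ->
     (f X' Y' <-> eq_dist Y Y')).

Definition one_to_one (R : realType) (A : randvar R -> Prop)
    (f : randvar R -> randvar R -> Prop) : Prop :=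
  forall X X' Y, A X -> A X' -> f X Y -> f X' Y -> eq_dist X X'.

Definition onto (R : realType) (A B : randvar R -> Prop)
    (f : randvar R -> randvar R -> Prop) : Prop :=
  forall Y, B Y -> exists2 X, A X & f X Y.

Definition mutually_inverse (R : realType) (A B : randvar R -> Prop)
    (f g : randvar R -> randvar R -> Prop) : Prop :=
  forall X Y, A X -> B Y -> (f X Y <-> g Y X).

(* Main.v *)
Require Import Defs.
From HB Require Import structures.
From mathcomp Require Import all_boot all_order all_algebra.
From mathcomp Require Import ring lra.
From mathcomp Require Import all_classical all_reals all_analysis.
From mathcomp Require Import measurable_realfun.

(** Let [X] have quantile function [H (L u)] and distribution function [F], and put
    [K x = L (F x)]. Left-continuity of [H] gives the Galois connection
    [y <= K x] iff [H y <= x], so [K] carries the Lebesgue measure of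
    the line to the Stieltjes measure [dH] on the positive half-line
    ([preimage_L_df], [phi_increments]). The weight [(1 - F) L(F)] is [K e^-K]; hence
    [phi(X)] has the law [t e^-t dH(t)], whose mass is 1 since
    [\int t e^-t dH(t) = \int (t - 1) e^-t H(t) dt] and [H] has the two means prescribed in
    H0 ([mean_identity]). Reading this backwards, [dH = e^t / t dP_T(t)] if [T] is the
    image, so [H] is determined by [T] up to a constant, and integrating [e^t / t] by parts
    against the law of [T] produces exactly the formula for [H_0]
    ([phi'_increments]). The constant is fixed by the centering condition, which both
    functions satisfy ([is_phi_is_phi']).

    No Stieltjes measure is constructed. Everything is said of a measure [mu], a function
    [K] and a weight [g] for which the [g]-mass of [a <= K < b] is [H b - H a]
    ([pushes_to_increments]). There are two instances: the Lebesgue measure with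
    [K = L o F] and [g = 1] where [K > 0], and the law of [T] with the identity and
    [g(t) = e^t / t].
    Tonelli's theorem over the region [s <= K < y], or [y <= K < s], turns the integral of
    [g Q(K)] into the integral of [|Q'|] against increments of [H]
    ([layer_cake_above], [layer_cake_below]). Two choices of [Q] carry the proof. With
    [t e^-t], it expresses the law of [T] by [H] ([mass_above], [mass_below]), so two
    positive variables with the same increments have the same law
    ([positive_law_unique]); this gives the converse implication
    ([is_phi'_is_phi]). With an incomplete gamma function ([upper_gamma]), it shows that
    all moments of [T] are finite when [H] is integrable against all
    [y^m e^-y] ([integral_phi_weight_moment]), and conversely that [H_0] is integrable
    against them when [T] has all its moments ([phi'_fun_integrable]). *)

Set Implicit Arguments.
Unset Strict Implicit.
Unset Printing Implicit Defensive.

Import Order.TTheory GRing.Theory Num.Theory.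
Import numFieldNormedType.Exports.

Local Open Scope classical_set_scope.
Local Open Scope ring_scope.

(** * Laws, distribution functions and quantiles *)

(** Closed right half-lines form a generating pi-system. This form
    of uniqueness is wanted besides the one by distribution functions because the
    layer-cake identities produce the masses of the half-lines [`[s, +oo[]. *)
Lemma probability_unique_ccdf (R : realType) (P Q : probability R R) :
  (forall x : R, P `[x, +oo[%classic = Q `[x, +oo[%classic) ->
  forall A : set R, measurable A -> P A = Q A.
Proof.
move=> PQ; apply: (measure_unique (@RGenCInfty.G R)
  (fun n : nat => `[- n%:R, +oo[%classic)).
- exact: RGenCInfty.measurableE.
- move=> _ _ [x ->] [y ->]; exists (Order.max x y).
  by apply/seteqP; split => z /=; rewrite !in_itv/= !andbT ge_max => /andP.
- by move=> n; eexists.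
- apply/seteqP; split => // x _; exists (Num.bound `|x|) => //=.
  by rewrite in_itv/= andbT ltW// ltrNl (le_lt_trans (ler_norm _))// normrN archi_boundP.
- by move=> _ [x ->]; exact: PQ.
- by move=> n; rewrite (le_lt_trans (probability_le1 _ _))// ltry.
Qed.

Lemma probability_unique_cdf (R : realType) (P Q : probability R R) :
  (forall x : R, P `]-oo, x]%classic = Q `]-oo, x]%classic) ->
  forall A : set R, measurable A -> P A = Q A.
Proof.
move=> PQ; apply: (measure_unique (@RGenOInfty.G R)
  (fun n : nat => `]- n%:R, +oo[%classic)).
- exact: RGenOInfty.measurableE.
- move=> _ _ [x ->] [y ->]; exists (Order.max x y).
  by apply/seteqP; split => z /=; rewrite !in_itv/= !andbT gt_max => /andP.
- by move=> n; eexists.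
- apply/seteqP; split => // x _; exists (Num.bound `|x|) => //=.
  by rewrite in_itv/= andbT ltrNl (le_lt_trans (ler_norm _))// normrN archi_boundP.
- move=> _ [x ->]; rewrite -setCitvl.
  by rewrite [LHS](probability_setC P)// [RHS](probability_setC Q)// PQ.
- by move=> n; rewrite (le_lt_trans (probability_le1 _ _))// ltry.
Qed.

Section randvar_distribution.
Context (R : realType).
Implicit Types (X Y : randvar R) (x u : R).

Lemma dfE X x : (df X x)%:E = Pr X `]-oo, x]%classic.
Proof. by rewrite /df fineK// fin_num_measure. Qed.

Lemma df_leftE X x : (df_left X x)%:E = Pr X `]-oo, x[%classic.
Proof. by rewrite /df_left fineK// fin_num_measure. Qed.

Lemma df_ge0 X x : 0 <= df X x.
Proof. by rewrite -lee_fin dfE. Qed.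

Lemma df_le1 X x : df X x <= 1.
Proof. by rewrite -lee_fin dfE probability_le1. Qed.

Lemma df_nd X : {homo df X : x y / x <= y}.
Proof. by move=> x y xy; rewrite -lee_fin !dfE; exact: cdf_nondecreasing. Qed.

Lemma df_left_nd X : {homo df_left X : x y / x <= y}.
Proof.
move=> x y xy; rewrite -lee_fin !df_leftE le_measure ?inE//.
by move=> t /=; rewrite !in_itv/= => /lt_le_trans; apply.
Qed.

Lemma df_left_le_df X x y : x <= y -> df_left X x <= df X y.
Proof.
move=> xy; rewrite -lee_fin df_leftE dfE le_measure ?inE//.
by move=> z /=; rewrite !in_itv/= => /ltW/le_trans; apply.
Qed.

Lemma Pr_itvcc X a b : a <= b ->
  Pr X `[a, b]%classic = (df X b - df_left X a)%:E.
Proof.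
move=> ab; rewrite EFinB dfE df_leftE.
have -> : `[a, b]%classic = `]-oo, b]%classic `\` `]-oo, a[%classic :> set R.
  by apply/seteqP; split => z /=; rewrite !in_itv/=;
    [move=> /andP[az ->]; rewrite ltNge az|move=> [-> /negP]; rewrite -leNgt => ->].
rewrite [LHS]measureD//; last by rewrite (le_lt_trans (probability_le1 _ _))// ltry.
by rewrite setIidr// => z /=; rewrite !in_itv/= => /ltW/le_trans; exact.
Qed.

Lemma Pr_itvco X a b : a <= b ->
  Pr X `[a, b[%classic = (df_left X b - df_left X a)%:E.
Proof.
move=> ab; rewrite EFinB !df_leftE.
have -> : `[a, b[%classic = `]-oo, b[%classic `\` `]-oo, a[%classic :> set R.
  by apply/seteqP; split => z /=; rewrite !in_itv/=;
    [move=> /andP[az ->]; rewrite ltNge az|move=> [-> /negP]; rewrite -leNgt => ->].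
rewrite [LHS]measureD//; last by rewrite (le_lt_trans (probability_le1 _ _))// ltry.
by rewrite setIidr// => z /=; rewrite !in_itv/= => za; exact: lt_le_trans ab.
Qed.

Lemma eq_dist_df X Y : eq_dist X Y <-> df X = df Y.
Proof.
split=> [XY|XY].
  by apply/funext => x; apply: EFin_inj; rewrite !dfE XY.
move=> A mA; apply: probability_unique_cdf => // x.
by rewrite -[LHS]/(Pr X _) -[RHS]/(Pr Y _) -!dfE XY.
Qed.

Lemma eq_dist_df_left X Y : eq_dist X Y -> df_left X = df_left Y.
Proof. by move=> XY; apply/funext => x; rewrite /df_left XY. Qed.

(** Quantiles and distribution functions form a Galois connection, because
    right-continuity of [df X] makes the infimum defining the quantile attained. *)
Lemma inv_df_le X u x : 0 < u < 1 -> (inv_df X u <= x) = (u <= df X x).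
Proof.
move=> /andP[u0 u1].
have rc : right_continuous (df X).
  move=> a; apply: fine_cvg; rewrite -[(fine _)%:E]/((df X a)%:E) dfE.
  exact: cdf_right_continuous.
have ub : has_inf [set z | u <= df X z].
  split.
    have : \forall z \near +oo, u <= df X z.
      exact: (cvgr_ge _ (fine_cvg (cvg_cdfy1 (rv_fun X)))).
    by move=> [M [_ /(_ (M + 1))]]; rewrite ltrDl ltr01 => /(_ isT); exists (M + 1).
  have : \forall z \near -oo, df X z < u.
    exact: (cvgr_lt _ (fine_cvg (cvg_cdfNy0 (rv_fun X)))).
  move=> [M [_ /(_ (M - 1))]]; rewrite gtrDl ltrN10 => /(_ isT) FM.
  exists (M - 1) => z /= uz; rewrite leNgt; apply/negP => zM.
  by have := le_lt_trans (le_trans uz (df_nd X (ltW zM))) FM; rewrite ltxx.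
apply/idP/idP; last first.
  by move=> ux; apply: ge_inf => //; exact: ub.2.
move=> invx; rewrite leNgt; apply/negP => Fx.
have /filter_ex[z [xz Fz]] : \forall z \near x^'+, x < z /\ df X z < u.
  by near=> z; split; near: z; [exact: nbhs_right_gt|exact: (cvgr_lt _ (rc x))].
have [s /= us sz] := inf_lt ub.1 (le_lt_trans invx xz).
by have := lt_le_trans Fz (le_trans us (df_nd X (ltW sz))); rewrite ltxx.
Unshelve. all: by end_near. Qed.

(** If the distribution functions differed at a point, a level [u] strictly between their
    two values there would contradict the Galois connection. *)
Lemma inv_df_determines_df X Y :
  (forall u, 0 < u < 1 -> inv_df X u = inv_df Y u) -> df X = df Y.
Proof.
move=> XY.
have le X' Y' x : (forall u, 0 < u < 1 -> inv_df X' u = inv_df Y' u) ->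
    df X' x <= df Y' x.
  move=> XY'; rewrite leNgt; apply/negP => YX.
  pose u := (df Y' x + df X' x) / 2.
  have [Yu uX] : df Y' x < u /\ u < df X' x by split; rewrite /u; lra.
  have u01 : 0 < u < 1.
    by rewrite (le_lt_trans (df_ge0 Y' x) Yu) (lt_le_trans uX (df_le1 X' x)).
  have := ltW uX; rewrite -inv_df_le// XY'// inv_df_le// leNgt.
  by rewrite Yu.
by apply/funext => x; apply/eqP; rewrite eq_le !le// => u /XY.
Qed.

Lemma eq_dist_inv_df X Y : eq_dist X Y <->
  forall u, 0 < u < 1 -> inv_df X u = inv_df Y u.
Proof.
split=> [/eq_dist_df XY u _|/inv_df_determines_df/eq_dist_df//].
by rewrite /inv_df XY.
Qed.

End randvar_distribution.

(** * Random variables with a prescribed quantile function or density *)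

(** Preimages of half-lines under a function monotone on an interval are intervals. The
    functions [H] of the theorem are monotone on the positive half-line only, hence
    the restriction to an interval. *)
Lemma nondecreasing_in_measurable (R : realType) (i : interval R) (f : R -> R) :
  {in i &, {homo f : x y / x <= y}} -> measurable_fun [set` i] f.
Proof.
move=> f_nd; apply: (measurability (@RGenCInfty.G R)) => [|/= _ [_] [r] -> <-].
  exact: RGenCInfty.measurableE.
apply: is_interval_measurable => s t /= [si fs] [ti ft] u /andP[su ut].
have ui : u \in i by apply: (interval_is_interval si ti); rewrite su ut.
split => //; move: fs ft; rewrite !in_itv/= !andbT => fs _.
by rewrite (le_trans fs)// f_nd.
Qed.

Lemma uniform_prob_itv (R : realType) (b1 b2 : bool) (x y : R) :
  0 <= x -> x <= y -> y <= 1 ->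
  uniform_prob (@ltr01 R) [set` Interval (BSide b1 x) (BSide b2 y)] = (y - x)%:E.
Proof.
move=> x0 xy y1; rewrite /uniform_prob integral_uniform_pdf setIidl.
  rewrite (eq_integral (cst 1%E)); last first.
    move=> z; rewrite inE/= => zi; rewrite /uniform_pdf ifT ?subr0 ?invr1//.
    move: zi; rewrite itv_boundlr => /andP[/= xz zy].
    have {}xz : x <= z by case: b1 xz; rewrite bnd_simp// => /ltW.
    have {}zy : z <= y by case: b2 zy; rewrite bnd_simp// => /ltW.
    by rewrite (le_trans x0)// (le_trans zy).
  rewrite integral_cst//= mul1e lebesgue_measure_itv/= lte_fin.
  by case: ltgtP xy => // ->; rewrite subrr.
move=> z /=; rewrite !itv_boundlr => /andP[/= xz zy]; rewrite !bnd_simp.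
have {}xz : x <= z by case: b1 xz; rewrite bnd_simp// => /ltW.
have {}zy : z <= y by case: b2 zy; rewrite bnd_simp// => /ltW.
by rewrite (le_trans x0)// (le_trans zy).
Qed.

(** The variable is [Q] itself under the uniform law on the unit interval: the set where
    it is at most [x] is an initial interval, and it contains [u] as soon as it contains
    all [v < u]. Left-continuity of [Q] is phrased as the order condition that makes this
    work: no value of [Q] exceeds the supremum of the previous ones. *)
Lemma exists_inv_df (R : realType) (Q : R -> R) :
  {in `]0, 1[ &, {homo Q : u v / u <= v}} ->
  (forall u x, 0 < u < 1 -> (forall v, 0 < v < u -> Q v <= x) -> Q u <= x) ->
  exists X : randvar R, forall u, 0 < u < 1 -> inv_df X u = Q u.
Proof.
move=> Q_nd Q_lc.
pose q : measurableTypeR R -> R := Q \_ `]0, 1[.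
have mq : measurable_fun setT q.
  apply: (measurable_restrictT _ _).1; first exact: measurable_itv.
  exact: nondecreasing_in_measurable.
have qE u : 0 < u < 1 -> q u = Q u.
  by move=> u01; rewrite /q patchE mem_set//= in_itv.
pose P : probability _ R := uniform_prob (@ltr01 R).
have PE b1 b2 x y : 0 <= x -> x <= y -> y <= 1 ->
    P [set` Interval (BSide b1 x) (BSide b2 y)] = (y - x)%:E.
  exact: uniform_prob_itv.
pose Xq : {mfun measurableTypeR R >-> R} := HB.pack q (isMeasurableFun.Build _ _ _ _ q mq).
pose X := @Randvar R _ (measurableTypeR R) P Xq; exists X => u u01.
have dfX x : (df X x)%:E = P [set v | q v <= x].
  by rewrite dfE /Pr /= /distribution /pushforward /preimage/=.
have mle x : measurable [set v | q v <= x].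
  have := mq measurableT _ (measurable_itv `]-oo, x]).
  by rewrite setTI /preimage/=.
have key x : (u <= df X x) = (Q u <= x).
  apply/idP/idP => [ux|Qux].
    rewrite leNgt; apply/negP => xQu.
    have [v /andP[v0 vu] xQv] : exists2 v, 0 < v < u & x < Q v.
      apply: contrapT => /forall2NP h; move: xQu; rewrite ltNge => /negP; apply.
      by apply: Q_lc => // v v0u; case: (h v) => // /negP; rewrite leNgt.
    suff : df X x <= v by move=> /(le_trans ux); rewrite leNgt vu.
    have v1 : v < 1 by rewrite (lt_trans vu)//; case/andP: u01.
    rewrite -lee_fin dfX.
    have -> : v%:E = (1 - P `[v, 1%R[%classic)%E.
      by rewrite PE ?(ltW v0) ?(ltW v1)// -EFinB opprB addrC subrK.
    rewrite -probability_setC// le_measure ?inE//; first exact: measurableC.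
    move=> w /= qw; rewrite in_itv/= => /andP[vw w1]; move: qw.
    rewrite qE; last by rewrite (lt_le_trans v0).
    by rewrite leNgt (lt_le_trans xQv)// Q_nd// in_itv/= ?v0 ?v1 ?w1 ?(lt_le_trans v0).
  rewrite -lee_fin dfX.
  have -> : u%:E = P `]0, u[%classic.
    by case/andP: u01 => u0 u1; rewrite PE ?subr0// ltW.
  rewrite le_measure ?inE// => v /=; rewrite in_itv/= => /andP[v0 vu].
  have v01 : 0 < v < 1 by rewrite v0 (lt_trans vu)//; case/andP: u01.
  by rewrite qE// (le_trans _ Qux)// Q_nd// ?in_itv// ltW.
by apply/eqP; rewrite eq_le inv_df_le// key lexx/= -key -inv_df_le.
Qed.

Lemma exists_has_density (R : realType) (w : R -> R) :
  measurable_fun setT w -> (forall x, 0 <= w x) ->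
  (\int[lebesgue_measure]_x (w x)%:E = 1)%E ->
  exists V : randvar R, has_density V w.
Proof.
move=> mw w0 w1; pose m (A : set R) := (\int[lebesgue_measure]_(x in A) (w x)%:E)%E.
have m0 : m set0 = 0%E by rewrite /m integral_set0.
have m_ge0 A : (0 <= m A)%E by apply: integral_ge0 => x _; rewrite lee_fin.
have m_sa : semi_sigma_additive m.
  move=> /= F mF tF mUF; rewrite /m; apply: cvg_toP.
    apply: ereal_nondecreasing_is_cvgn => i j ij.
    by apply: lee_sum_nneg_natr => // k _ _; exact: m_ge0.
  rewrite ge0_integral_bigcup//=; first by apply/measurable_EFinP/measurable_funTS.
  by move=> x _; rewrite lee_fin.
pose mm : {measure set R -> \bar R} :=
  HB.pack m (isMeasure.Build _ _ _ m m0 m_ge0 m_sa).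
pose P : probability R R :=
  HB.pack m (Measure.on mm) (Measure_isProbability.Build _ _ _ mm w1).
pose V : {mfun R >-> R} := HB.pack (@id R)
  (isMeasurableFun.Build _ _ _ _ (@id R) (@measurable_id _ _ setT)).
by exists (@Randvar R _ _ P V).
Qed.

(** * Tonelli over a relation and the layer-cake identities *)

Local Notation leb := lebesgue_measure.

Lemma measurable_set_bool d (T : measurableType d) (b : T -> bool) :
  measurable_fun setT b -> measurable [set z | b z].
Proof.
by move=> mb; rewrite -[X in measurable X]setTI; exact: (mb measurableT [set true]).
Qed.

Lemma itv0y_cut1 (R : realType) :
  `]0%R, +oo[%classic = `]0, 1[%classic `|` `[1, +oo[%classic :> set R.
Proof. by rewrite (@itv_bndbnd_setU _ _ _ (BLeft 1)) ?bnd_simp. Qed.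

Lemma disjoint_itv0y_cut1 (R : realType) :
  [disjoint (`]0, 1[%classic : set R) & `[1, +oo[%classic].
Proof.
apply/disj_set2P/seteqP; split => // y [] /=; rewrite !in_itv/= andbT.
by move=> /andP[_ y1]; rewrite leNgt y1.
Qed.

Section integral_over_relation.
Context d1 d2 (T1 : measurableType d1) (T2 : measurableType d2) (R : realType).
Variables (m1 : {sigma_finite_measure set T1 -> \bar R}).
Variables (m2 : {sigma_finite_measure set T2 -> \bar R}).
Variables (B : set (T1 * T2)) (f : T1 * T2 -> R).
Hypotheses (mB : measurable B) (mf : measurable_fun setT f).

Let patch1 x y : ((fun y' => (f (x, y'))%:E) \_ [set y' | B (x, y')]) y =
  ((EFin \o f) \_ B) (x, y).
Proof. by rewrite !patchE /= /in_mem /=; congr (if _ then _ else _). Qed.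

Let patch2 x y : ((fun x' => (f (x', y))%:E) \_ [set x' | B (x', y)]) x =
  ((EFin \o f) \_ B) (x, y).
Proof. by rewrite !patchE /= /in_mem /=; congr (if _ then _ else _). Qed.

Let mfB : measurable_fun setT ((EFin \o f) \_ B).
Proof.
by apply: (measurable_restrictT _ _).1 => //; apply/measurable_EFinP/measurable_funTS.
Qed.

(** The inner domain depends on the outer variable; extending the integrand by 0 outside
    the relation [B] reduces the exchange to the product measure. *)
Lemma tonelli_relation : (forall z, B z -> 0 <= f z) ->
  (\int[m1]_x \int[m2]_(y in [set y | B (x, y)]) (f (x, y))%:E =
   \int[m2]_y \int[m1]_(x in [set x | B (x, y)]) (f (x, y))%:E)%E.
Proof.
move=> f0; under eq_integral do rewrite integral_mkcond.
under [RHS]eq_integral do rewrite integral_mkcond.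
under eq_integral do under eq_integral do rewrite patch1.
under [RHS]eq_integral do under eq_integral do rewrite patch2.
rewrite (fubini_tonelli ((EFin \o f) \_ B))// => z.
by apply: erestrict_ge0 => {}z Bz; rewrite lee_fin f0.
Qed.

Lemma fubini_relation :
  (\int[m2]_y \int[m1]_(x in [set x | B (x, y)]) (`|f (x, y)|)%:E < +oo)%E ->
  (\int[m1]_x \int[m2]_(y in [set y | B (x, y)]) (f (x, y))%:E =
   \int[m2]_y \int[m1]_(x in [set x | B (x, y)]) (f (x, y))%:E)%E.
Proof.
move=> foo; under eq_integral do rewrite integral_mkcond.
under [RHS]eq_integral do rewrite integral_mkcond.
under eq_integral do under eq_integral do rewrite patch1.
under [RHS]eq_integral do under eq_integral do rewrite patch2.
rewrite (Fubini (f := (EFin \o f) \_ B))//; apply/integrable21ltyP => //.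
apply: le_lt_trans foo; rewrite le_eqVlt; apply/orP; left; apply/eqP.
apply: eq_integral => y _; rewrite [RHS]integral_mkcond; apply: eq_integral => x _.
rewrite !patchE /= /in_mem /=.
rewrite [in_set [set _ | _] _](_ : _ = in_set B (x, y))//.
by case: ifPn => _; rewrite ?abse0// ?normr0.
Qed.

End integral_over_relation.

Section layer_cake.
Context d (T : measurableType d) (R : realType).
Variables (mu : {sigma_finite_measure set T -> \bar R}) (K g : T -> R) (H : R -> R).

(** The image under [K] of the measure [g mu] agrees on the positive half-line with the
    Stieltjes measure [dH] of the left-continuous function [H]. Speaking of the masses of
    the intervals [`[a, b[] only spares the construction of [dH]. *)
Definition pushes_to_increments := forall a b, 0 < a -> a <= b ->
  (\int[mu]_(w in K @^-1` `[a, b[) (g w)%:E = (H b - H a)%:E)%E.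

Hypotheses (mK : measurable_fun setT K) (mg : measurable_fun setT g).
Hypotheses (g0 : forall w, 0 <= g w) (KgH : pushes_to_increments).

Lemma measurable_preimage_itv (i : interval R) : measurable (K @^-1` [set` i]).
Proof. by rewrite -[X in measurable X]setTI; apply: mK. Qed.

(** Integrate [g w * q y] over the region [s <= K w < y] in both orders: fixing [w] leaves
    the tail integral [Q (K w)] of [q], fixing [y] leaves the increment [H y - H s]. *)
Lemma layer_cake_above (q Q : R -> R) (s : R) : 0 < s ->
  measurable_fun setT q -> (forall y, s < y -> 0 <= q y) ->
  (forall t, s <= t -> (\int[leb]_(y in `]t, +oo[) (q y)%:E = (Q t)%:E)%E) ->
  (\int[mu]_(w in K @^-1` `[s, +oo[) (g w * Q (K w))%:E =
   \int[leb]_(y in `]s, +oo[) (q y * (H y - H s))%:E)%E.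
Proof.
move=> s0 mq q0 qQ.
have mq' D : measurable_fun D (EFin \o q) by apply/measurable_EFinP/measurable_funTS.
have mg' D : measurable_fun D (EFin \o g) by apply/measurable_EFinP/measurable_funTS.
pose B : set (T * R) := [set z | (s <= K z.1) && (K z.1 < z.2)].
pose f (z : T * R) := g z.1 * q z.2.
have mK1 : measurable_fun setT (fun z : T * R => K z.1) by exact: measurableT_comp.
have mB : measurable B.
  apply: measurable_set_bool; apply: measurable_and.
    exact: measurable_fun_ler.
  exact: measurable_fun_ltr.
have mf : measurable_fun setT f by apply: measurable_funM; exact: measurableT_comp.
have f0 z : B z -> 0 <= f z.
  by move=> /andP[sK Kz]; rewrite mulr_ge0// q0// (le_lt_trans sK).
have := tonelli_relation mu leb mB mf f0; rewrite /f /B /=.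
rewrite [X in X = _ -> _](_ : _ =
    \int[mu]_(w in K @^-1` `[s, +oo[) (g w * Q (K w))%:E)%E; last first.
  rewrite [RHS]integral_mkcond; apply: eq_integral => w _; rewrite patchE.
  case: ifPn => [|/negP]; rewrite inE/= in_itv/= andbT => sK; last first.
    rewrite (_ : mkset _ = set0) ?integral_set0//.
    by apply/seteqP; split => // y /= /andP[].
  rewrite EFinM -qQ// -ge0_integralZl_EFin//.
  - have -> // : [set y | s <= K w < y] = `]K w, +oo[%classic.
    by apply/seteqP; split => y /=; rewrite sK in_itv/= andbT.
  - by move=> y /=; rewrite in_itv/= andbT => Ky; rewrite lee_fin q0// (le_lt_trans sK).
  - exact: mq'.
move=> ->; rewrite [RHS]integral_mkcond; apply: eq_integral => y _; rewrite patchE.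
case: ifPn => [|/negP]; rewrite inE/= in_itv/= andbT => sy; last first.
  rewrite (_ : mkset _ = set0) ?integral_set0//.
  by apply/seteqP; split => // w /= /andP[sK Ky]; apply: sy; exact: le_lt_trans Ky.
rewrite EFinM -KgH//; last exact: ltW.
rewrite -ge0_integralZl_EFin ?q0//.
- have -> : [set w | s <= K w < y] = K @^-1` `[s, y[%classic.
    by apply/seteqP; split => w /=; rewrite in_itv.
  by apply: eq_integral => w _; rewrite -EFinM mulrC.
- exact: measurable_preimage_itv.
- by move=> w _; rewrite lee_fin.
Qed.

(** The same exchange over the region [0 < y <= K w < s]. *)
Lemma layer_cake_below (q Q : R -> R) (s : R) : 0 < s ->
  measurable_fun setT q -> (forall y, 0 < y < s -> 0 <= q y) ->
  (forall t, 0 < t < s -> (\int[leb]_(y in `]0%R, t]) (q y)%:E = (Q t)%:E)%E) ->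
  (\int[mu]_(w in K @^-1` `]0%R, s[) (g w * Q (K w))%:E =
   \int[leb]_(y in `]0%R, s[) (q y * (H s - H y))%:E)%E.
Proof.
move=> s0 mq q0 qQ.
have mq' D : measurable_fun D (EFin \o q) by apply/measurable_EFinP/measurable_funTS.
have mg' D : measurable_fun D (EFin \o g) by apply/measurable_EFinP/measurable_funTS.
pose B : set (T * R) := [set z | (0 < z.2) && ((z.2 <= K z.1) && (K z.1 < s))].
pose f (z : T * R) := g z.1 * q z.2.
have mK1 : measurable_fun setT (fun z : T * R => K z.1) by exact: measurableT_comp.
have mB : measurable B.
  apply: measurable_set_bool; apply: measurable_and.
    exact: measurable_fun_ltr.
  by apply: measurable_and; [exact: measurable_fun_ler|exact: measurable_fun_ltr].
have mf : measurable_fun setT f by apply: measurable_funM; exact: measurableT_comp.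
have f0 z : B z -> 0 <= f z.
  by move=> /andP[z0 /andP[zK Ks]]; rewrite mulr_ge0// q0// z0 (le_lt_trans zK).
have := tonelli_relation mu leb mB mf f0; rewrite /f /B /=.
rewrite [X in X = _ -> _](_ : _ =
    \int[mu]_(w in K @^-1` `]0%R, s[) (g w * Q (K w))%:E)%E; last first.
  rewrite [RHS]integral_mkcond; apply: eq_integral => w _; rewrite patchE.
  case: ifPn => [|/negP]; rewrite inE/= in_itv/= => Ks; last first.
    rewrite (_ : mkset _ = set0) ?integral_set0//.
    apply/seteqP; split => // y /= /and3P[y0 yK wKs]; apply: Ks.
    by rewrite wKs (lt_le_trans y0).
  rewrite EFinM -qQ// -ge0_integralZl_EFin//.
  - have -> // : [set y | (0 < y) && (y <= K w < s)] = `]0%R, K w]%classic.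
    by apply/seteqP; split => y /=; rewrite in_itv/=; case/andP: Ks => _ ->; rewrite andbT.
  - move=> y /=; rewrite in_itv/= => /andP[y0 yK]; rewrite lee_fin q0// y0.
    by rewrite (le_lt_trans yK)//; case/andP: Ks.
  - exact: mq'.
move=> ->; rewrite [RHS]integral_mkcond; apply: eq_integral => y _; rewrite patchE.
case: ifPn => [|/negP]; rewrite inE/= in_itv/= => sy; last first.
  rewrite (_ : mkset _ = set0) ?integral_set0//.
  apply/seteqP; split => // w /= /and3P[y0 yK Ks]; apply: sy.
  by rewrite y0 (le_lt_trans yK).
case/andP: (sy) => y0 ys; rewrite EFinM -KgH//; last exact: ltW.
rewrite -ge0_integralZl_EFin ?q0//.
- have -> : [set w | (0 < y) && (y <= K w < s)] = K @^-1` `[y, s[%classic.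
    by apply/seteqP; split => w /=; rewrite in_itv y0.
  by apply: eq_integral => w _; rewrite -EFinM mulrC.
- exact: measurable_preimage_itv.
- by move=> w _; rewrite lee_fin.
Qed.

End layer_cake.

(** * Incomplete gamma integrals *)

Section exponential_integrals.
Context (R : realType).
Implicit Types (t y : R) (m : nat).

Lemma is_derive_powexp m y : is_derive y 1
  (fun z : R => z ^+ m * expR (- z)) (m%:R * y ^+ m.-1 * expR (- y) - y ^+ m * expR (- y)).
Proof.
have dE : is_derive y 1 (fun z : R => expR (- z)) (- expR (- y)).
  have := @is_derive1_comp R expR -%R y (expR (- y)) (-1) _ _.
  by rewrite mulrN1; apply.
have dX : is_derive y 1 (fun z : R => z ^+ m) (m%:R * y ^+ m.-1).
  have := @is_deriveX R R id m y 1 1 _; rewrite scaler1.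
  by rewrite exprfctE; apply.
apply: is_derive_eq (is_deriveM dX dE) _.
by rewrite -!/(_ * _) /GRing.scale/=; ring.
Qed.

Lemma continuous_powexp m : continuous (fun z : R => z ^+ m * expR (- z)).
Proof.
move=> y; apply: differentiable_continuous; apply/derivable1_diffP.
by have [] := is_derive_powexp m y.
Qed.

(** The exponential series gives [y ^+ m.+1 / m.+1`! <= expR y]. *)
Lemma powexp_cvgy0 m : z ^+ m * expR (- z) @[z --> (+oo : set_system R)] --> 0.
Proof.
apply/cvgr0Pnorm_le => e e0; near=> y.
have y0 : 0 < y by near: y; exact: nbhs_pinfty_gt.
have ey : m.+1`!%:R / e <= y by near: y; apply: nbhs_pinfty_ge; exact: num_real.
rewrite ger0_norm ?mulr_ge0 ?exprn_ge0 ?expR_ge0 ?(ltW y0)//.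
rewrite expRN ler_pdivrMr ?expR_gt0//.
rewrite (le_trans _ (ler_wpM2l (ltW e0) (expR_ge1Dxn m (ltW y0))))// mulrDr mulr1.
rewrite -[leLHS]add0r lerD ?(ltW e0)// exprS.
have f0 : 0 < m.+1`!%:R :> R by rewrite ltr0n fact_gt0.
have -> : e * (y * y ^+ m / m.+1`!%:R) = y ^+ m * (y * e / m.+1`!%:R) by ring.
by rewrite ler_peMr ?exprn_ge0 ?(ltW y0)// ler_pdivlMr// mul1r -ler_pdivrMr.
Unshelve. all: by end_near. Qed.

Lemma integral_itvoy_derive (f F : R -> R) t :
  continuous f -> (forall y, is_derive y 1 F (f y)) ->
  F y @[y --> +oo] --> 0 -> (forall y, t <= y -> 0 <= f y) ->
  (\int[leb]_(y in `]t, +oo[) (f y)%:E = (- F t)%:E)%E.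
Proof.
move=> cf dF F0 f0; rewrite integral_itv_obnd_cbnd; last first.
  by apply/measurable_EFinP/measurable_funTS; exact: continuous_measurable_fun.
rewrite (@ge0_continuous_FTC2y _ f F t 0)//.
- by rewrite sub0e EFinN.
- exact: continuous_subspaceT.
- apply: cvg_at_right_filter; apply: differentiable_continuous.
  by apply/derivable1_diffP; have [] := dF t.
- by move=> x _; rewrite derive1E; exact: derive_val.
Qed.

Lemma integral_itvcc_derive (f F : R -> R) (a b : R) : a < b ->
  (forall y, a <= y <= b -> {for y, continuous f}) ->
  (forall y, a <= y <= b -> is_derive y 1 F (f y)) ->
  (\int[leb]_(y in `[a, b]) (f y)%:E = (F b - F a)%:E)%E.
Proof.
move=> ab cf dF.
have cF y : a <= y <= b -> {for y, continuous F}.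
  move=> yab; apply: differentiable_continuous.
  by apply/derivable1_diffP; have [] := dF y yab.
rewrite (@continuous_FTC2 _ f F a b)//.
- apply: continuous_in_subspaceT => x; rewrite inE/= in_itv/=; exact: cf.
- split.
  + by move=> x; rewrite in_itv/= => /andP[ax xb]; have [] := dF x; rewrite ?ltW.
  + by apply: cvg_at_right_filter; apply: cF; rewrite lexx ltW.
  + by apply: cvg_at_left_filter; apply: cF; rewrite lexx ltW.
- move=> x; rewrite in_itv/= => /andP[ax xb].
  by rewrite derive1E; have := dF x; rewrite !ltW// => /(_ isT) [].
Qed.

(** The function of [t] with limit 0 at infinity and derivative [- t ^+ m * expR (- t)],
    in the closed form obtained by iterated integration by parts. *)
Fixpoint upper_gamma m t : R :=
  if m is m'.+1 then t ^+ m * expR (- t) + m%:R * upper_gamma m' t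
  else expR (- t).

Lemma upper_gamma_ge m t : 0 <= t -> t ^+ m * expR (- t) <= upper_gamma m t.
Proof.
move=> t0; case: m => [|m]; first by rewrite expr0 mul1r.
rewrite /= lerDl mulr_ge0//; elim: m => [|m IH]; first exact: expR_ge0.
by rewrite /= addr_ge0 ?mulr_ge0 ?exprn_ge0 ?expR_ge0.
Qed.

(** With [upper_gamma_ge] this compares [upper_gamma m t] on [`[1, +oo[] with its leading
    term. It is what makes integrability of [H] against all [y ^+ m * expR (- y)] the same
    thing as finiteness of all moments of the law [t e^-t dH(t)]. *)
Lemma upper_gamma_le m : exists2 C : R, 0 <= C &
  forall t, 1 <= t -> upper_gamma m t <= C * (t ^+ m * expR (- t)).
Proof.
elim: m => [|m [C C0 IH]]; first by exists 1 => // t _ /=; rewrite expr0 !mul1r.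
exists (1 + m.+1%:R * C); first by rewrite addr_ge0 ?mulr_ge0.
move=> t t1 /=; rewrite mulrDl mul1r lerD2l -mulrA ler_wpM2l//.
rewrite (le_trans (IH t t1))// ler_wpM2l// ler_wpM2r ?expR_ge0//.
by rewrite exprS ler_peMl// exprn_ge0// (le_trans _ t1).
Qed.

Lemma is_derive_upper_gamma m y : is_derive y 1 (upper_gamma m) (- (y ^+ m * expR (- y))).
Proof.
elim: m => [|m IH].
  have := is_derive_powexp 0 y; rewrite mulr0n !mul0r sub0r expr0 !mul1r.
  by rewrite (_ : (fun z => _) = upper_gamma 0)//; apply/funext => z; rewrite expr0 mul1r.
have dG : is_derive y 1 (fun z : R => m.+1%:R * upper_gamma m z)
    (- (m.+1%:R * (y ^+ m * expR (- y)))).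
  by apply: is_derive_eq (is_deriveZ m.+1%:R IH) _; rewrite /GRing.scale/= mulrN.
apply: is_derive_eq (is_deriveD (is_derive_powexp m.+1 y) dG) _ => /=; ring.
Qed.

Lemma upper_gamma_cvgy0 m : upper_gamma m y @[y --> (+oo : set_system R)] --> 0.
Proof.
elim: m => [|m IH] /=; first exact: cvgr_expR.
rewrite -[X in _ --> X]addr0; apply: cvgD; first exact: (@powexp_cvgy0 m.+1).
by rewrite -(mulr0 m.+1%:R); apply: cvgM => //; exact: cvg_cst.
Qed.

Lemma continuous_upper_gamma m : continuous (upper_gamma m).
Proof.
move=> y; apply: differentiable_continuous; apply/derivable1_diffP.
by have [] := is_derive_upper_gamma m y.
Qed.

Lemma integral_gamma m t : 0 <= t ->
  (\int[leb]_(y in `]t, +oo[) (y ^+ m * expR (- y))%:E = (upper_gamma m t)%:E)%E.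
Proof.
move=> t0.
have dG y : is_derive y 1 (fun z => - upper_gamma m z) (y ^+ m * expR (- y)).
  by apply: is_derive_eq (is_deriveN (is_derive_upper_gamma m y)) _; rewrite opprK.
rewrite (integral_itvoy_derive _ dG) ?opprK//.
- exact: continuous_powexp.
- by rewrite -oppr0; apply: cvgN; exact: upper_gamma_cvgy0.
- by move=> y ty; rewrite mulr_ge0 ?exprn_ge0 ?expR_ge0// (le_trans t0).
Qed.

Let dyexp y : is_derive y 1 (fun z : R => z * expR (- z)) ((1 - y) * expR (- y)).
Proof.
by apply: is_derive_eq (is_derive_powexp 1 y) _; rewrite /= expr0 expr1; ring.
Qed.

Let cyexp : continuous (fun z : R => (1 - z) * expR (- z)).
Proof.
have -> : (fun z : R => (1 - z) * expR (- z)) =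
    (fun z => z ^+ 0 * expR (- z)) \- (fun z => z ^+ 1 * expR (- z)).
  by apply/funext => z /=; rewrite expr0 expr1; ring.
by move=> z; apply: cvgB; exact: continuous_powexp.
Qed.

(** [y e^-y] is the primitive of [(1 - y) e^-y] vanishing at 0 and at infinity. The sign of
    the integrand changes at 1, which is why half-lines starting above 1 and intervals
    ending below 1 are treated apart from here on. *)
Lemma integral_subr1_exp t : 1 <= t ->
  (\int[leb]_(y in `]t, +oo[) ((y - 1) * expR (- y))%:E = (t * expR (- t))%:E)%E.
Proof.
move=> t1.
have dG y : is_derive y 1 (fun z : R => - (z * expR (- z))) ((y - 1) * expR (- y)).
  by apply: is_derive_eq (is_deriveN (dyexp y)) _; rewrite -mulNr opprB.
rewrite (integral_itvoy_derive _ dG) ?opprK//.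
- have -> : (fun z : R => (z - 1) * expR (- z)) = \- (fun z : R => (1 - z) * expR (- z)).
    by apply/funext => z /=; rewrite -mulNr opprB.
  by move=> z; apply: cvgN; exact: cyexp.
- by rewrite -oppr0; apply: cvgN; exact: (@powexp_cvgy0 1).
- by move=> y ty; rewrite mulr_ge0 ?expR_ge0// subr_ge0 (le_trans t1).
Qed.

Lemma integral_1subr_exp t : 0 < t ->
  (\int[leb]_(y in `]0%R, t]) ((1 - y) * expR (- y))%:E = (t * expR (- t))%:E)%E.
Proof.
move=> t0; rewrite integral_itv_obnd_cbnd; last first.
  by apply/measurable_EFinP/measurable_funTS; exact: continuous_measurable_fun.
by rewrite (integral_itvcc_derive t0 (fun y _ => @cyexp y) (fun y _ => dyexp y)) mul0r subr0.
Qed.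

End exponential_integrals.

(** * Integration by parts against a law *)

(** Inversion is discontinuous at 0; on each half-line it is the real power of
    exponent -1. *)
Lemma measurable_inv (R : realType) : measurable_fun setT (fun x : R => x^-1).
Proof.
have -> : (fun x : R => x^-1) = fun x => if 0 <= x then x `^ (-1) else - ((- x) `^ (-1)).
  apply/funext => x; case: ifPn => [x0|]; first by rewrite powR_inv1.
  by rewrite -ltNge => x0; rewrite powR_inv1 ?oppr_ge0 ?(ltW x0)// invrN opprK.
apply: measurable_fun_ifT; [exact: measurable_fun_ler|exact: measurable_powR|].
apply: measurableT_comp => //; apply: (measurableT_comp (measurable_powR _)).
exact: oppr_measurable.
Qed.

Section by_parts.
Context (R : realType).
Implicit Types (f : R -> R) (a b x y z : R).

Lemma Rintegral_itvcc_split f x y z : x <= y -> y <= z ->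
  leb.-integrable `[x, z] (EFin \o f) ->
  \int[leb]_(t in `[x, z]) f t =
    \int[leb]_(t in `[x, y]) f t + \int[leb]_(t in `[y, z]) f t.
Proof.
move=> xy yz fi; have fyz : leb.-integrable `]y, z] (EFin \o f).
  apply: integrableS fi => // t /=; rewrite !in_itv/= => /andP[yt tz].
  by rewrite tz (le_trans xy (ltW yt)).
rewrite -(Rintegral_itv_obnd_cbnd fyz) -(Rintegral_itvB fi) ?bnd_simp//.
by rewrite addrC subrK.
Qed.

Lemma oriented_integralB f a b : 0 < a -> a <= b ->
  (forall x y, 0 < x -> leb.-integrable `[x, y] (EFin \o f)) ->
  oriented_integral 1 b f - oriented_integral 1 a f = \int[leb]_(t in `[a, b]) f t.
Proof.
move=> a0 ab fi; rewrite /oriented_integral.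
have [b1|b1] := leP 1 b; have [a1|a1] := leP 1 a.
- by rewrite (Rintegral_itvcc_split a1 ab (fi _ _ ltr01)) addrAC subrr add0r.
- by rewrite opprK addrC -(Rintegral_itvcc_split (ltW a1) b1 (fi _ _ a0)).
- by have := lt_le_trans b1 (le_trans a1 ab); rewrite ltxx.
- rewrite (Rintegral_itvcc_split ab (ltW b1) (fi _ _ a0)) opprK; ring.
Qed.

Let k y : R := expR y / y.

(** The derivative of [k]. *)
Let psi y : R := (y - 1) / y ^+ 2 * expR y.

Let psi_continuous y : 0 < y -> {for y, continuous psi}.
Proof.
move=> y0; apply: continuousM; last exact: continuous_expR.
apply: continuousM; first by apply: continuousB; [exact: cvg_id|exact: cvg_cst].
apply: continuousV; first by rewrite expf_neq0 ?gt_eqF.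
exact: exprn_continuous.
Qed.

Let dk y : 0 < y -> is_derive y 1 k (psi y).
Proof.
move=> y0; have dV := @is_deriveV R id y 1 1 (negbT (gt_eqF y0)) _.
apply: is_derive_eq (is_deriveM (is_derive_expR y) (dV _)) _.
rewrite /GRing.scale/= /psi; field; exact: negbT (gt_eqF y0).
Qed.

Lemma integral_psi a b : 0 < a -> a <= b ->
  (\int[leb]_(y in `[a, b]) (psi y)%:E = (k b - k a)%:E)%E.
Proof.
move=> a0; rewrite le_eqVlt => /orP[/eqP<-|ab].
  by rewrite set_itv1 integral_set1 subrr.
have cpsi y : a <= y <= b -> {for y, continuous psi}.
  by move=> /andP[ay _]; exact: psi_continuous (lt_le_trans a0 ay).
have dkpsi y : a <= y <= b -> is_derive y 1 k (psi y).
  by move=> /andP[ay _]; exact: dk (lt_le_trans a0 ay).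
exact: integral_itvcc_derive ab cpsi dkpsi.
Qed.

Lemma integrable_psi a b : 0 < a -> leb.-integrable `[a, b] (EFin \o psi).
Proof.
move=> a0; apply: continuous_compact_integrable; first exact: segment_compact.
apply: continuous_in_subspaceT => x; rewrite inE/= in_itv/= => /andP[ax _].
by apply: psi_continuous; exact: lt_le_trans ax.
Qed.


Variables (d : measure_display) (T : measurableType d).
Variables (mu : {sigma_finite_measure set T -> \bar R}) (K p : T -> R) (Y : randvar R).
Hypotheses (mK : measurable_fun setT K) (mp : measurable_fun setT p).
Hypotheses (p0 : forall w, 0 <= p w).
Hypothesis PY : forall A : set R, measurable A ->
  Pr Y A = (\int[mu]_(w in K @^-1` A) (p w)%:E)%E.

Let Pr_cc a s : a <= s ->
  (\int[mu]_(w in K @^-1` `[a, s]) (p w)%:E = (df Y s - df_left Y a)%:E)%E.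
Proof. by move=> as_; rewrite -PY// Pr_itvcc. Qed.

Let Pr_co a b : a <= b ->
  (\int[mu]_(w in K @^-1` `[a, b[) (p w)%:E = (df_left Y b - df_left Y a)%:E)%E.
Proof. by move=> ab; rewrite -PY// Pr_itvco. Qed.

Let mpsi : measurable_fun setT (psi \_ `]0, +oo[).
Proof.
apply: (measurable_restrictT _ _).1; first exact: measurable_itv.
apply: open_continuous_measurable_fun => // x; rewrite inE/= in_itv/= andbT.
exact: psi_continuous.
Qed.

Let mp' D : measurable_fun D (EFin \o p).
Proof. by apply/measurable_EFinP/measurable_funTS. Qed.

Let mpre (i : interval R) : measurable (K @^-1` [set` i]).
Proof. exact: measurable_preimage_itv. Qed.

Let mdf : measurable_fun setT (df Y).
Proof. by apply: nondecreasing_measurable => //; exact: df_nd. Qed.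

Lemma integrable_psi_df a b : 0 < a ->
  leb.-integrable `[a, b] (EFin \o (fun x => psi x * df Y x)).
Proof.
move=> a0; apply: le_integrable (integrable_psi b a0) => //.
  apply/measurable_EFinP; apply: measurable_funM.
    by apply/measurable_EFinP; exact: measurable_int (integrable_psi b a0).
  exact: measurable_funTS.
move=> x _ /=; rewrite lee_fin normrM ler_piMr// ger0_norm ?df_ge0//.
exact: df_le1.
Qed.

(** [k b - k (K w)] is the integral of [psi] from [K w] to [b]. As [psi] changes sign at 1,
    the exchange is Fubini's, justified by the integrability of [psi] on [`[a, b]]. *)
Let fubini_step a b : 0 < a -> a < b ->
  (\int[mu]_(w in K @^-1` `[a, b[) (p w * (k b - k (K w)))%:E =
   \int[leb]_(s in `[a, b]) (psi s * (df Y s - df_left Y a))%:E)%E.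
Proof.
move=> a0 ab.
pose B : set (T * R) := [set z | (a <= K z.1) && ((K z.1 <= z.2) && (z.2 < b))].
pose f (z : T * R) := p z.1 * (psi \_ `]0, +oo[) z.2.
have mK1 : measurable_fun setT (fun z : T * R => K z.1) by exact: measurableT_comp.
have mB : measurable B.
  apply: measurable_set_bool; apply: measurable_and.
    exact: measurable_fun_ler.
  by apply: measurable_and; [exact: measurable_fun_ler|exact: measurable_fun_ltr].
have mf : measurable_fun setT f by apply: measurable_funM; exact: measurableT_comp.
have psiE y : 0 < y -> (psi \_ `]0, +oo[) y = psi y.
  by move=> y0; rewrite patchE mem_set//= in_itv/= y0.
have section_lt y : a <= y -> y < b -> [set w | B (w, y)] = K @^-1` `[a, y]%classic.
  move=> ay yb; apply/seteqP; split => w; rewrite /B /= in_itv/= yb andbT => //.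
have section0 y : ~ (a <= y < b) -> [set w | B (w, y)] = set0.
  move=> yab; apply/seteqP; split => // w; rewrite /B /= => /and3P[aK Ky yb].
  by apply: yab; rewrite yb (le_trans aK).
(* At a fixed [y] the relation leaves the outcomes with [K w] in [`[a, y]], whose mass
   is [df Y y - df_left Y a]. *)
have inner c y : a <= y ->
    (\int[mu]_(w in K @^-1` `[a, y]) (p w * c)%:E = (c * (df Y y - df_left Y a))%:E)%E.
  move=> ay; rewrite EFinM -Pr_cc// -integralZl//; last first.
    apply/integrableP; split; first exact: mp'.
    under eq_integral do rewrite /= ger0_norm//.
    by rewrite Pr_cc// ltry.
  by apply: eq_integral => w _; rewrite -EFinM mulrC.
have dfB y : a <= y -> 0 <= df Y y - df_left Y a <= 1.
  move=> ay; rewrite subr_ge0 df_left_le_df//= lerBlDr (le_trans (df_le1 _ _))//.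
  by rewrite lerDl -lee_fin df_leftE.
have outer (phi : R -> R) : (\int[leb]_y \int[mu]_(w in [set w | B (w, y)]) (p w * phi y)%:E =
    \int[leb]_(y in `[a, b[) (phi y * (df Y y - df_left Y a))%:E)%E.
  rewrite [RHS]integral_mkcond; apply: eq_integral => y _; rewrite patchE.
  case: ifPn => [|/negP]; rewrite inE/= in_itv/= => yab; last first.
    by rewrite section0// integral_set0.
  by case/andP: yab => ay yb; rewrite section_lt// inner.
have mb D : measurable_fun D (fun y => df Y y - df_left Y a).
  by apply: measurable_funB => //; exact: measurable_funTS.
have psi_pos y : y \in `[a, b] -> (psi \_ `]0, +oo[) y = psi y.
  by rewrite in_itv/= => /andP[ay _]; rewrite psiE// (lt_le_trans a0).
have co_cc : {subset `[a, b[ <= `[a, b]}.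
  by move=> y; rewrite !in_itv/= => /andP[-> /ltW].
have foo : (\int[leb]_y \int[mu]_(w in [set w | B (w, y)]) `|f (w, y)|%:E < +oo)%E.
  have /integrableP[mpsi_ab] := integrable_psi b a0.
  apply: le_lt_trans.
  have := outer (fun y => `|(psi \_ `]0, +oo[) y|).
  under eq_integral do under eq_integral => w _ do rewrite -[p w]ger0_norm// -normrM.
  move=> ->; rewrite (integral_itv_bndo_bndc (f := fun y => _)); last first.
    apply/measurable_EFinP; apply: measurable_funM (mb _).
    by apply: measurableT_comp => //; exact: measurable_funTS.
  apply: ge0_le_integral => //.
  - by move=> y /= /[!in_itv]/= /andP[ay _]; rewrite lee_fin mulr_ge0//; case/andP: (dfB y ay).
  - apply/measurable_EFinP; apply: measurable_funM (mb _).
    by apply: measurableT_comp => //; exact: measurable_funTS.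
  - exact: measurableT_comp.
  - move=> y /= yab; rewrite psi_pos// lee_fin ler_piMr//.
    by move: yab; rewrite in_itv/= => /andP[ay _]; case/andP: (dfB y ay).
have := @fubini_relation _ _ _ _ _ mu leb B f mB mf foo.
rewrite outer integral_itv_bndo_bndc; last first.
  by apply/measurable_EFinP; apply: measurable_funM (mb _); exact: measurable_funTS.
rewrite [X in _ = X -> _](_ : _ =
    \int[leb]_(s in `[a, b]) (psi s * (df Y s - df_left Y a))%:E)%E; last first.
  by apply: eq_integral => y; rewrite inE => yab; rewrite psi_pos.
move=> <-; rewrite integral_mkcond; apply: eq_integral => w _; rewrite patchE.
case: ifPn => [|/negP]; rewrite inE/= in_itv/= => Kab; last first.
  rewrite (_ : mkset _ = set0) ?integral_set0//.
  apply/seteqP; split => // y; rewrite /B /= => /and3P[aK Ky yb].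
  by apply: Kab; rewrite aK (le_lt_trans Ky).
case/andP: Kab => aK Kb; have K0 := lt_le_trans a0 aK.
rewrite EFinM -(integral_psi K0 (ltW Kb)) -integralZl//; last first.
  exact: integrable_psi.
rewrite -[LHS]integral_itv_bndo_bndc; last first.
  apply: emeasurable_funM => //.
  apply: (measurable_funS _ _ (measurable_int _ (integrable_psi b K0))) => //.
  by move=> y /=; rewrite !in_itv/= => /andP[-> /ltW].
have -> : [set y | B (w, y)] = `[K w, b[%classic.
  by apply/seteqP; split => y; rewrite /B /= in_itv/= aK.
apply: eq_integral => y; rewrite inE/= in_itv/= => /andP[Ky _].
by rewrite /f /= psiE// (lt_le_trans K0).
Qed.

(** If [Y] has weight [p] then [p e^K / K] is the weight of [e^t / t dP_Y(t)]. Integrating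
    [e^t / t] by parts against the distribution function of [Y] over [`[a, b[] gives the
    boundary terms and the oriented integral that define [phi'_fun]; the constant [c]
    cancels in increments. *)
Lemma phi'_increments c :
  pushes_to_increments mu K (fun w => p w * (expR (K w) / K w)) (phi'_fun Y c).
Proof.
move=> a b a0; rewrite le_eqVlt => /orP[/eqP<-|ab].
  by rewrite set_itvco0 preimage_set0 integral_set0 subrr.
set D := K @^-1` _.
have -> : phi'_fun Y c b - phi'_fun Y c a = k b * df_left Y b - k a * df_left Y a -
    \int[leb]_(s in `[a, b]) (psi s * df Y s).
  rewrite -(oriented_integralB a0 (ltW ab)) => [|x y x0]; last exact: integrable_psi_df.
  by rewrite /phi'_fun /k /psi; ring.
have mD : measurable D by exact: mpre.
have ip : mu.-integrable D (EFin \o p).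
  apply/integrableP; split; first exact: mp'.
  under eq_integral do rewrite /= ger0_norm//.
  by rewrite Pr_co ?ltW// ltry.
have kb0 : 0 < expR b / a by rewrite divr_gt0 ?expR_gt0.
have ik : mu.-integrable D (fun w => (p w * k (K w))%:E).
  have := integrableZl mD (expR b / a) ip; apply: le_integrable => //.
    apply/measurable_EFinP; apply: measurable_funTS; apply: measurable_funM => //.
    by apply: measurableT_comp mK; apply: measurable_funM => //; exact: measurable_inv.
  move=> w; rewrite /D /= in_itv/= => /andP[aK Kb]; have K0 := lt_le_trans a0 aK.
  rewrite lee_fin (normrM (p w)) (normrM (expR b / a)) mulrC ler_wpM2r//.
  rewrite !ger0_norm ?(ltW kb0) ?divr_ge0 ?expR_ge0 ?(ltW K0)//.
  by rewrite ler_pM ?expR_ge0 ?invr_ge0 ?(ltW K0) ?ler_expR ?(ltW Kb)// lef_pV2 ?posrE.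
have := fubini_step a0 ab.
have -> : (\int[mu]_(w in D) (p w * (k b - k (K w)))%:E =
    (k b * (df_left Y b - df_left Y a))%:E - \int[mu]_(w in D) (p w * k (K w))%:E)%E.
  rewrite EFinM -Pr_co ?(ltW ab)// -integralZl//.
  rewrite -integralB//; last exact: integrableZl.
  by apply: eq_integral => w _ /=; rewrite -EFinM -EFinB; congr EFin; ring.
have -> : (\int[leb]_(s in `[a, b]) (psi s * (df Y s - df_left Y a))%:E)%E =
    (\int[leb]_(s in `[a, b]) (psi s * df Y s) - (k b - k a) * df_left Y a)%:E.
  rewrite EFinB EFinM -(integral_psi a0 (ltW ab)) muleC -integralZl//; last first.
    exact: integrable_psi.
  rewrite /Rintegral fineK; last exact/integrable_fin_num/integrable_psi_df.
  rewrite -integralB//.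
  - by apply: eq_integral => s _ /=; rewrite -EFinD; congr EFin; ring.
  - exact: integrable_psi_df.
  - exact/integrableZl/integrable_psi.
have : (\int[mu]_(w in D) (p w * k (K w))%:E)%E \is a fin_num by exact: integrable_fin_num.
rewrite /k; case: (\int[mu]_(w in D) _)%E => // r _; rewrite -EFinB => -[e].
congr EFin; move: e; rewrite /k; set kb := expR b / b; set ka := expR a / a => e.
by rewrite -[LHS](subKr (kb * (df_left Y b - df_left Y a))) e; ring.
Qed.

End by_parts.

(** * Weighted laws and increments *)

Section represented_law.
Context (R : realType) (d : measure_display) (T : measurableType d).
Variables (mu : {sigma_finite_measure set T -> \bar R}) (K p : T -> R) (H : R -> R).
Hypotheses (mK : measurable_fun setT K) (mp : measurable_fun setT p).
Hypotheses (p0 : forall w, 0 <= p w) (pK : forall w, p w != 0 -> 0 < K w).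

(** Undoing the factor [t e^-t] in the law [t e^-t dH(t)] leaves [dH]. *)
Let g w := p w * (expR (K w) / K w).

Hypothesis KgH : pushes_to_increments mu K g H.

Lemma measurable_tilt : measurable_fun setT g.
Proof.
apply: measurable_funM => //; apply: (measurableT_comp (f := fun x => expR x / x)) => //.
by apply: measurable_funM => //; exact: measurable_inv.
Qed.

Lemma tilt_ge0 w : 0 <= g w.
Proof.
rewrite /g; have [->|/pK K0] := eqVneq (p w) 0; first by rewrite mul0r.
by rewrite mulr_ge0// divr_ge0 ?expR_ge0// ltW.
Qed.

Lemma tiltK w : 0 < K w -> g w * (K w * expR (- K w)) = p w.
Proof.
move=> K0; rewrite /g expRN.
have e0 : expR (K w) != 0 by rewrite gt_eqF ?expR_gt0.
by field; rewrite e0 gt_eqF.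
Qed.

(** The layer-cake identities for [Q t = t e^-t]: the increments of [H] determine the masses
    of half-lines under the weighted law. *)
Lemma mass_above s : 1 <= s ->
  (\int[mu]_(w in K @^-1` `[s, +oo[%classic) (p w)%:E =
   \int[leb]_(y in `]s, +oo[) ((y - 1) * expR (- y) * (H y - H s))%:E)%E.
Proof.
move=> s1; have s0 : 0 < s by exact: lt_le_trans s1.
rewrite -(layer_cake_above mK measurable_tilt tilt_ge0 KgH
    (Q := fun t => t * expR (- t)) s0).
- apply: eq_integral => w; rewrite inE/= in_itv/= andbT => sK.
  by rewrite tiltK// (lt_le_trans s0).
- apply: measurable_funM; first exact: measurable_funB.
  by apply: measurableT_comp => //; exact: oppr_measurable.
- by move=> y sy; rewrite mulr_ge0 ?expR_ge0// subr_ge0 (le_trans s1)// ltW.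
- by move=> t st; rewrite integral_subr1_exp// (le_trans s1).
Qed.

Lemma mass_below s : 0 < s -> s <= 1 ->
  (\int[mu]_(w in K @^-1` `]0%R, s[%classic) (p w)%:E =
   \int[leb]_(y in `]0%R, s[) ((1 - y) * expR (- y) * (H s - H y))%:E)%E.
Proof.
move=> s0 s1.
rewrite -(layer_cake_below mK measurable_tilt tilt_ge0 KgH
    (Q := fun t => t * expR (- t)) s0).
- by apply: eq_integral => w; rewrite inE/= in_itv/= => /andP[K0 Ks]; rewrite tiltK.
- apply: measurable_funM; first exact: measurable_funB.
  by apply: measurableT_comp => //; exact: oppr_measurable.
- move=> y /andP[y0 ys]; rewrite mulr_ge0 ?expR_ge0// subr_ge0 (le_trans _ s1)//.
  exact: ltW.
- by move=> t /andP[t0 _]; rewrite integral_1subr_exp.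
Qed.

(** Moments of the weighted law above 1 are integrals of [H]. *)
Lemma integral_tilt_gamma m :
  (\int[mu]_(w in K @^-1` `[1%R, +oo[%classic) (g w * upper_gamma m (K w))%:E =
   \int[leb]_(y in `]1%R, +oo[) (y ^+ m * expR (- y) * (H y - H 1))%:E)%E.
Proof.
apply: (layer_cake_above mK measurable_tilt tilt_ge0 KgH) => //.
- apply: continuous_measurable_fun; exact: continuous_powexp.
- by move=> y y1; rewrite mulr_ge0 ?expR_ge0// exprn_ge0// (le_trans _ (ltW y1)).
- by move=> t t1; rewrite integral_gamma// (le_trans _ t1).
Qed.

Lemma integral_tilt_id :
  (\int[mu]_(w in K @^-1` `]0%R, 1%R[%classic) (g w * K w)%:E =
   \int[leb]_(y in `]0%R, 1%R[) (H 1 - H y)%:E)%E.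
Proof.
rewrite (layer_cake_below mK measurable_tilt tilt_ge0 KgH (q := cst 1) (Q := id))//.
  by apply: eq_integral => y _; rewrite mul1r.
move=> t /andP[t0 _]; transitivity (\int[leb]_(y in `]0%R, t]) cst 1%E y)%E => //.
rewrite integral_cst//= mul1e lebesgue_measure_itv/= lte_fin t0.
by rewrite oppr0 adde0.
Qed.

End represented_law.

(** The masses of [`[s, +oo[] for [s] between 0 and 1 are those of the complements of
    [`]0, s[] in the positive half-line, which carries both laws. *)
Lemma positive_law_unique (R : realType) (Y Z : randvar R) :
  Pr Y `]0, +oo[%classic = 1%E -> Pr Z `]0, +oo[%classic = 1%E ->
  (forall s, 1 <= s -> Pr Y `[s, +oo[%classic = Pr Z `[s, +oo[%classic) ->
  (forall s, 0 < s -> s <= 1 -> Pr Y `]0, s[%classic = Pr Z `]0, s[%classic) ->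
  eq_dist Y Z.
Proof.
move=> Y1 Z1 above below A mA; apply: probability_unique_ccdf => //= x.
rewrite -[LHS]/(Pr Y _) -[RHS]/(Pr Z _).
have full W : Pr W `]0, +oo[%classic = 1%E -> x <= 0 -> Pr W `[x, +oo[%classic = 1%E.
  move=> W1 x0; apply/eqP; rewrite eq_le probability_le1// -W1 le_measure ?inE//.
  by move=> z /=; rewrite !in_itv/= !andbT => /ltW; exact: le_trans.
have split W : Pr W `]0, +oo[%classic = 1%E -> 0 < x ->
    Pr W `[x, +oo[%classic = (1 - Pr W `]0%R, x[%classic)%E.
  move=> W1 x0; rewrite -W1.
  have -> : `[x, +oo[%classic = `]0, +oo[%classic `\` `]0, x[%classic :> set R.
    apply/seteqP; split => z /=; rewrite !in_itv/= !andbT.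
      by move=> xz; rewrite (lt_le_trans x0)// ltNge xz.
    by move=> [-> /negP]; rewrite -leNgt.
  rewrite [LHS]measureD//.
    by rewrite setIidr// => z /=; rewrite !in_itv/= andbT => /andP[].
  by rewrite (le_lt_trans (probability_le1 _ _))// ltry.
have [x0|x0] := leP x 0; first by rewrite !full.
have [x1|x1] := leP 1 x; first exact: above.
by rewrite !split// below// ltW.
Qed.

(** * Integrals against a density, and means of increasing functions *)

(** Both sides are the integral over [r >= 0] of the mass of the set where [k] exceeds
    [r]. *)
Lemma integral_has_density (R : realType) (V : randvar R) (f k : R -> R) :
  has_density V f -> measurable_fun setT f -> (forall x, 0 <= f x) ->
  measurable_fun setT k -> (forall x, 0 <= k x) ->
  (\int[rv_prob V]_w (k (rv_fun V w))%:E = \int[leb]_x (f x * k x)%:E)%E.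
Proof.
move=> Vf mf f0 mk k0.
have mkV : measurable_fun setT (k \o rv_fun V) by exact: measurableT_comp.
pose kV : {RV (rv_prob V) >-> R} := HB.pack (k \o rv_fun V)
  (isMeasurableFun.Build _ _ _ _ (k \o rv_fun V) mkV).
have := @ge0_expectation_ccdf _ _ _ _ kV (fun w => k0 _).
rewrite expectation_def => ->.
pose B : set (R * R) := [set z | (0 <= z.1) && (z.1 < k z.2)].
have mB : measurable B.
  apply: measurable_set_bool; apply: measurable_and.
    exact: measurable_fun_ler.
  by apply: measurable_fun_ltr => //; exact: measurableT_comp.
have mfB : measurable_fun setT (fun z : R * R => f z.2) by exact: measurableT_comp.
have := tonelli_relation leb leb mB mfB (fun z _ => f0 _).
rewrite /B /= => e.
transitivity (\int[leb]_r \int[leb]_(x in [set x | (0 <= r < k x)%R]) (f x)%:E)%E.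
  rewrite integral_mkcond; apply: eq_integral => r _; rewrite patchE.
  case: ifPn => [|/negP]; rewrite inE/= in_itv/= andbT => r0; last first.
    by rewrite (_ : mkset _ = set0) ?integral_set0//; apply/seteqP; split => // x /= /andP[].
  transitivity (Pr V (k @^-1` `]r, +oo[%classic)); first by [].
  rewrite Vf; last by rewrite -[X in measurable X]setTI; exact: mk.
  by congr (integral _ _ _); apply/seteqP; split => x /=; rewrite in_itv/= andbT r0.
rewrite e; apply: eq_integral => x _.
rewrite (_ : mkset _ = `[0, k x[%classic)%R; last first.
  by apply/seteqP; split => r /=; rewrite in_itv.
transitivity (\int[leb]_(r in `[0%R, k x[) cst (f x)%:E r)%E => //.
rewrite integral_cst//= lebesgue_measure_itv/= lte_fin.
case: ltgtP (k0 x) => // [kx _|<- _]; last by rewrite mule0 mulr0.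
by rewrite oppr0 adde0.
Qed.

Section Hstar_integrals.
Context (R : realType) (H : R -> R).
Hypothesis HH : Hstar_fun H.

Lemma Hstar_measurable : measurable_fun (`]0, +oo[%classic : set R) H.
Proof. by case: HH => _ Hnd _ _; exact: nondecreasing_in_measurable. Qed.

Lemma Hstar_integrable m :
  leb.-integrable `]0, +oo[ (fun y => (y ^+ m * expR (- y) * H y)%:E).
Proof.
case: HH => _ _ _ /(_ m) fin; apply/integrableP; split.
  apply/measurable_EFinP; apply: measurable_funM; last exact: Hstar_measurable.
  apply: measurable_funTS; apply: continuous_measurable_fun.
  exact: continuous_powexp.
apply: le_lt_trans fin; rewrite le_eqVlt; apply/orP; left; apply/eqP.
apply: eq_integral => y; rewrite inE/= in_itv/= andbT => y0.
by rewrite normrM ger0_norm// mulr_ge0 ?expR_ge0 ?exprn_ge0// ltW.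
Qed.


End Hstar_integrals.

Section mean_identity.
Context (R : realType).

Lemma integrable_powexp m :
  leb.-integrable `]0, +oo[ (fun y : R => (y ^+ m * expR (- y))%:E).
Proof.
apply/integrableP; split.
  apply/measurable_EFinP; apply: measurable_funTS.
  by apply: continuous_measurable_fun; exact: continuous_powexp.
apply: (@le_lt_trans _ _ (upper_gamma m (0 : R))%:E); last exact: ltry.
rewrite -integral_gamma// le_eqVlt; apply/orP; left; apply/eqP.
apply: eq_integral => y; rewrite inE/= in_itv/= andbT => y0.
by rewrite /= ger0_norm// mulr_ge0 ?expR_ge0 ?exprn_ge0// ltW.
Qed.

Lemma integrable_expN : leb.-integrable `]0, +oo[ (fun y : R => (expR (- y))%:E).
Proof. by apply: eq_integrable (integrable_powexp 0) => // y _; rewrite expr0 mul1r. Qed.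

Lemma integrable_idexpN :
  leb.-integrable `]0, +oo[ (fun y : R => (y * expR (- y))%:E).
Proof. by apply: eq_integrable (integrable_powexp 1) => // y _; rewrite expr1. Qed.

Lemma integral_exp0y : (\int[leb]_(y in `]0%R, +oo[) (expR (- y : R))%:E = 1)%E.
Proof.
have := @integral_gamma R 0 0 (lexx _); rewrite /= oppr0 expR0 => <-.
by apply: eq_integral => y _; rewrite expr0 mul1r.
Qed.

Lemma integral_idexp0y : (\int[leb]_(y in `]0%R, +oo[) (y * expR (- y : R))%:E = 1)%E.
Proof.
have := @integral_gamma R 1 0 (lexx _); rewrite /= oppr0 expR0 expr1 mul0r add0r mul1r => <-.
by apply: eq_integral => y _; rewrite expr1.
Qed.

Variable H : R -> R.
Hypothesis iH : forall m,
  leb.-integrable `]0, +oo[ (fun y => (y ^+ m * expR (- y) * H y)%:E).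

Lemma integrable_increment m (c : R) :
  leb.-integrable `]0, +oo[ (fun y => (y ^+ m * expR (- y) * (H y - c))%:E).
Proof.
have -> : (fun y => (y ^+ m * expR (- y) * (H y - c))%:E) =
    (fun y => (y ^+ m * expR (- y) * H y)%:E - c%:E * (y ^+ m * expR (- y))%:E)%E.
  by apply/funext => y; rewrite -EFinM -EFinB; congr EFin; ring.
by apply: integrableB => //; apply: integrableZl => //; exact: integrable_powexp.
Qed.

(** On both pieces the integrand is [(y - 1) e^-y (H y - H 1)], and the constant [H 1]
    drops out because [y e^-y] and [e^-y] both have integral 1. With [mass_above] and
    [mass_below] at [s = 1], the left-hand side is the total mass of [t e^-t dH(t)]. *)
Lemma mean_identity :
  (\int[leb]_(y in `]1%R, +oo[) ((y - 1) * expR (- y) * (H y - H 1))%:E +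
   \int[leb]_(y in `]0%R, 1%R[) ((1 - y) * expR (- y) * (H 1 - H y))%:E =
   \int[leb]_(y in `]0%R, +oo[) (y * expR (- y) * H y)%:E -
   \int[leb]_(y in `]0%R, +oo[) (expR (- y) * H y)%:E)%E.
Proof.
pose f y := (y - 1) * expR (- y) * (H y - H 1).
have iH1 : leb.-integrable `]0, +oo[ (fun y => (y * expR (- y) * H y)%:E).
  by apply: eq_integrable (iH 1) => // y _; rewrite expr1.
have iH0 : leb.-integrable `]0, +oo[ (fun y => (expR (- y) * H y)%:E).
  by apply: eq_integrable (iH 0) => // y _; rewrite expr0 mul1r.
have i1 := integrable_idexpN; have i0 := integrable_expN.
have fE : (EFin \o f = (fun y => (y * expR (- y) * H y)%:E - (expR (- y) * H y)%:E
    - (H 1)%:E * ((y * expR (- y))%:E - (expR (- y))%:E)))%E.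
  by apply/funext => y; rewrite /f /= -EFinD; congr EFin; ring.
have iB : leb.-integrable `]0, +oo[ (fun y => (y * expR (- y) * H y)%:E - (expR (- y) * H y)%:E)%E.
  exact: integrableB.
have iB1 : leb.-integrable `]0, +oo[ (fun y : R => (y * expR (- y))%:E - (expR (- y))%:E)%E.
  exact: integrableB.
have fi : leb.-integrable `]0, +oo[ (EFin \o f).
  by rewrite fE; apply: integrableB => //; exact: integrableZl.
transitivity (\int[leb]_(y in `]0%R, +oo[) (f y)%:E)%E; last first.
  transitivity (\int[leb]_(y in `]0%R, +oo[) (EFin \o f) y)%E => //.
  rewrite fE integralB//; last exact: integrableZl.
  rewrite integralZl// !integralB// integral_exp0y integral_idexp0y.
  by rewrite subee// mule0 sube0.
have sub1 : (`]0, 1[%classic : set R) `<=` `]0, +oo[%classic.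
  by move=> y /=; rewrite !in_itv/= andbT => /andP[].
have sub2 : (`[1, +oo[%classic : set R) `<=` `]0, +oo[%classic.
  by move=> y /=; rewrite !in_itv/= !andbT; exact: lt_le_trans.
have fi1 : leb.-integrable `]0, 1[ (EFin \o f) by exact: integrableS fi.
have fi2 : leb.-integrable `[1, +oo[ (EFin \o f) by exact: integrableS fi.
rewrite itv0y_cut1 integral_setU//; last 2 first.
- by rewrite -itv0y_cut1; exact: measurable_int fi.
- exact: disjoint_itv0y_cut1.
rewrite addeC; congr (_ + _)%E.
  by apply: eq_integral => y _; congr EFin; rewrite /f; ring.
rewrite integral_itv_obnd_cbnd//.
apply: (measurable_funS _ _ (measurable_int _ fi2)) => //.
by move=> y /=; rewrite !in_itv/= !andbT => /ltW.
Qed.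

End mean_identity.

(** * The image of a variable of H0 under phi *)

Section phi_of_H0.
Context (R : realType) (X : randvar R) (H : R -> R).
Hypotheses (HH : H0_fun H) (XH : forall u : R, 0 < u < 1 -> inv_df X u = H (L u)).

(** The domain of [K] and [p] is ascribed the measurable structure that carries the
    Lebesgue measure, to which [pushes_to_increments] refers. *)
Let K : measurableTypeR R -> R := fun x => L (df X x).
Let p : measurableTypeR R -> R := phi_weight X.

Lemma measurable_L_df : measurable_fun setT K.
Proof.
rewrite /K /L; apply: measurable_funN.
apply: (measurableT_comp (@measurable_ln R)); apply: measurable_funB => //.
by apply: nondecreasing_measurable => //; exact: df_nd.
Qed.

Lemma L_df_ge0 x : 0 <= K x.
Proof.
by rewrite oppr_ge0 ln_le0// lerBlDr lerDl df_ge0.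
Qed.

(** [1 - F = e^-K] where [F < 1]; where [F = 1] both sides are 0, since then [K] is 0. *)
Lemma phi_weightE x : p x = K x * expR (- K x).
Proof.
rewrite /p /phi_weight -/(K x) mulrC /K /L opprK.
have : df X x <= 1 := df_le1 X x.
rewrite le_eqVlt => /orP[/eqP->|F1]; first by rewrite subrr ln0// oppr0 !mul0r.
by rewrite lnK// posrE subr_gt0.
Qed.

Lemma phi_weight_ge0 x : 0 <= p x.
Proof. by rewrite phi_weightE mulr_ge0 ?expR_ge0 ?L_df_ge0. Qed.

Lemma phi_weight_neq0 x : p x != 0 -> 0 < K x.
Proof.
rewrite phi_weightE lt0r L_df_ge0 andbT; apply: contra_neq => ->.
by rewrite mul0r.
Qed.

Lemma measurable_phi_weight : measurable_fun setT p.
Proof.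
rewrite (_ : p = fun x => K x * expR (- K x)); last by apply/funext => x; exact: phi_weightE.
apply: measurable_funM; first exact: measurable_L_df.
apply: measurableT_comp => //; apply: measurableT_comp; first exact: oppr_measurable.
exact: measurable_L_df.
Qed.

Lemma inv_df_exp y : 0 < y -> inv_df X (1 - expR (- y)) = H y.
Proof.
move=> y0; rewrite XH; first by rewrite /L opprB addrC subrK expRK opprK.
by rewrite subr_gt0 expR_lt1 oppr_lt0 y0 /= gtrDl oppr_lt0 expR_gt0.
Qed.

(** The Galois connection of [inv_df_le] read on the scale [u = 1 - e^-y]. *)
Lemma le_H_df y x : 0 < y -> (H y <= x) = (1 - expR (- y) <= df X x).
Proof.
move=> y0; rewrite -inv_df_exp// inv_df_le//.
by rewrite subr_gt0 expR_lt1 oppr_lt0 y0 /= gtrDl oppr_lt0 expR_gt0.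
Qed.

(** [K] and [H] are inverse to each other in the sense of Galois connections, so the
    Lebesgue measure of the left-hand side is [H b - H a]. *)
Lemma preimage_L_df a b : 0 < a -> 0 < b ->
  K @^-1` `[a, b[%classic = `[H a, H b[%classic.
Proof.
move=> a0 b0; apply/seteqP; split => x /=; rewrite !in_itv/=; last first.
  move=> /andP[Ha Hb].
  have F1 : df X x < 1.
    rewrite ltNge; apply/negP => F1; move: Hb; rewrite ltNge le_H_df// => /negP; apply.
    by rewrite (le_trans _ F1)// gerDl oppr_le0 expR_ge0.
  have e : df X x = 1 - expR (- K x) by rewrite /K /L opprK lnK ?posrE ?subr_gt0// subKr.
  move: Ha Hb; rewrite ltNge !le_H_df// e !lerD2l !lerN2 !ler_expR !lerN2 => -> /=.
  by rewrite -ltNge.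
move=> /andP[aK Kb].
have F1 : df X x < 1.
  rewrite ltNge; apply/negP => F1; move: aK.
  by rewrite /K /L ln0 ?subr_le0// oppr0 leNgt a0.
have e : df X x = 1 - expR (- K x) by rewrite /K /L opprK lnK ?posrE ?subr_gt0// subKr.
by rewrite ltNge !le_H_df// e !lerD2l !lerN2 !ler_expR !lerN2 aK -ltNge.
Qed.

Lemma phi_increments : pushes_to_increments lebesgue_measure K
  (fun x => p x * (expR (K x) / K x)) H.
Proof.
move=> a b a0 ab; have b0 := lt_le_trans a0 ab.
transitivity (\int[leb]_(x in K @^-1` `[a, b[%classic) cst 1%E x)%E.
  apply: eq_integral => x; rewrite inE/= in_itv/= => /andP[aK _].
  rewrite phi_weightE /cst expRN; have K0 := lt_le_trans a0 aK.
  by congr EFin; field; rewrite !gt_eqF ?expR_gt0.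
rewrite preimage_L_df// integral_cst//= mul1e lebesgue_measure_itv/= lte_fin.
have : H a <= H b by case: HH => -[_ Hnd _ _] _ _; apply: Hnd; rewrite ?in_itv/= ?a0 ?b0.
by rewrite le_eqVlt => /orP[/eqP->|->//]; rewrite ltxx subrr.
Qed.

Let mass_ge1 := mass_above measurable_L_df measurable_phi_weight phi_weight_ge0
  phi_weight_neq0 phi_increments.
Let mass_lt1 := mass_below measurable_L_df measurable_phi_weight phi_weight_ge0
  phi_weight_neq0 phi_increments.

Let mpre (i : interval R) : measurable (K @^-1` [set` i]).
Proof. exact: (measurable_preimage_itv measurable_L_df). Qed.

Let mp' D : measurable_fun D (EFin \o p).
Proof. by apply/measurable_EFinP/measurable_funTS; exact: measurable_phi_weight. Qed.

(** The weight vanishes where [L (F x)] does. *)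
Lemma integral_phi_weight_split (h : R -> R) : measurable_fun setT h ->
  (forall x, 0 <= h x) ->
  (\int[leb]_x (p x * h x)%:E =
   \int[leb]_(x in K @^-1` `[1%R, +oo[%classic) (p x * h x)%:E +
   \int[leb]_(x in K @^-1` `]0%R, 1%R[%classic) (p x * h x)%:E)%E.
Proof.
move=> mh h0.
have mph D : measurable_fun D (fun x => (p x * h x)%:E).
  apply/measurable_EFinP/measurable_funTS; apply: measurable_funM => //.
  exact: measurable_phi_weight.
transitivity (\int[leb]_(x in K @^-1` `]0%R, +oo[%classic) (p x * h x)%:E)%E.
  rewrite [RHS]integral_mkcond; apply: eq_integral => x _; rewrite patchE.
  case: ifPn => // /negP; rewrite inE/= in_itv/= andbT => K0.
  have [->|/phi_weight_neq0//] := eqVneq (p x) 0; first by rewrite mul0r.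
have -> : K @^-1` `]0%R, +oo[%classic = K @^-1` `[1%R, +oo[ `|` K @^-1` `]0%R, 1%R[.
  apply/seteqP; split => x /=; rewrite !in_itv/= !andbT.
    by move=> K0; have [K1|K1] := leP 1 (K x); [left|right; rewrite K0].
  by case=> [|/andP[]//]; exact: lt_le_trans.
rewrite ge0_integral_setU//; first by move=> x _; rewrite lee_fin mulr_ge0 ?phi_weight_ge0.
apply/disj_set2P/seteqP; split => // x [] /=; rewrite !in_itv/= andbT.
by move=> K1 /andP[_]; rewrite ltNge K1.
Qed.

(** The normalizing constant of the density is 1: by [mean_identity] the mass is the
    difference of the two means prescribed in [H0_fun]. *)
Lemma integral_phi_weight : (\int[leb]_x (p x)%:E = 1)%E.
Proof.
have := integral_phi_weight_split (measurable_cst (1 : R)) (fun _ => ler01).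
under eq_integral do rewrite mulr1.
under [X in (_ = X + _)%E -> _]eq_integral do rewrite mulr1.
under [X in (_ = _ + X)%E -> _]eq_integral do rewrite mulr1.
move=> ->; rewrite mass_ge1// mass_lt1// mean_identity.
  by case: HH => _ -> ->; rewrite sube0.
by case: HH => + _ _; exact: Hstar_integrable.
Qed.

Lemma phi_densityE : phi_density X = p.
Proof.
apply/funext => x; rewrite /phi_density.
by rewrite /Rintegral -/p integral_phi_weight divr1.
Qed.

(** Below 1 the power of [K] is at most 1. Above 1, [p K^n] is
    [g K^(n+1) e^-K] with [g = p e^K / K], hence at most [g] times an incomplete gamma
    function of [K], whose integral is one of [H] by [integral_tilt_gamma]. *)
Lemma integral_phi_weight_moment n : (\int[leb]_x (p x * K x ^+ n)%:E < +oo)%E.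
Proof.
rewrite integral_phi_weight_split; last 2 first.
- by apply: measurable_funX; exact: measurable_L_df.
- by move=> x; rewrite exprn_ge0 ?L_df_ge0.
have mpn D : measurable_fun D (fun x => (p x * K x ^+ n)%:E).
  apply/measurable_EFinP/measurable_funTS; apply: measurable_funM.
    exact: measurable_phi_weight.
  by apply: measurable_funX; exact: measurable_L_df.
have pn0 x : (0 <= (p x * K x ^+ n)%:E)%E.
  by rewrite lee_fin mulr_ge0 ?exprn_ge0 ?L_df_ge0 ?phi_weight_ge0.
rewrite lte_add_pinfty//.
- have := integral_tilt_gamma measurable_L_df measurable_phi_weight phi_weight_ge0
    phi_weight_neq0 phi_increments n.+1.
  set I := (X in _ = X -> _) => e.
  apply: (@le_lt_trans _ _ I).
    rewrite -e; apply: ge0_le_integral => //.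
    + apply/measurable_EFinP/measurable_funTS; apply: measurable_funM.
        exact: (measurable_tilt measurable_L_df measurable_phi_weight).
      apply: measurableT_comp measurable_L_df; apply: continuous_measurable_fun.
      exact: continuous_upper_gamma.
    + move=> x /=; rewrite in_itv/= andbT => K1; have K0 := lt_le_trans ltr01 K1.
      have := upper_gamma_ge n.+1 (ltW K0).
      rewrite lee_fin => /(ler_wpM2l (tilt_ge0 phi_weight_ge0 phi_weight_neq0 x)).
      apply: le_trans; rewrite -{1}(tiltK p K0) le_eqVlt; apply/orP; left; apply/eqP.
      by rewrite exprS; ring.
  apply: integrable_lty => //; apply: integrableS (integrable_increment _ n.+1 (H 1)) => //.
    by move=> y /=; rewrite !in_itv/= !andbT; exact: lt_trans.
  by case: HH => + _ _; exact: Hstar_integrable.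
- have : (\int[leb]_(x in K @^-1` `]0%R, 1%R[) (p x)%:E < +oo)%E.
    apply: (@le_lt_trans _ _ 1%E); last exact: ltry.
    rewrite -integral_phi_weight; apply: ge0_subset_integral => //.
    by move=> x _; rewrite lee_fin phi_weight_ge0.
  apply: le_lt_trans; apply: ge0_le_integral => //.
  + move=> x /=; rewrite in_itv/= => /andP[K0 K1].
    by rewrite lee_fin ler_piMr ?phi_weight_ge0// exprn_ile1// ltW.
Qed.

Let mpreK (A : set R) : measurable A -> measurable (K @^-1` A).
Proof. by move=> mA; rewrite -[X in measurable X]setTI; exact: measurable_L_df. Qed.

Lemma exists_phi_density : exists V : randvar R, has_density V (phi_density X).
Proof.
rewrite phi_densityE; apply: exists_has_density.
- exact: measurable_phi_weight.
- exact: phi_weight_ge0.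
- exact: integral_phi_weight.
Qed.

(** The auxiliary variable [V] enters the law of the image only through its density. *)
Lemma is_phiP (T : randvar R) : is_phi X T <->
  forall A : set R, measurable A ->
    Pr T A = (\int[lebesgue_measure]_(x in K @^-1` A) (p x)%:E)%E.
Proof.
have PV V A : has_density V (phi_density X) -> measurable A ->
    rv_prob V [set w | A (L (df X (rv_fun V w)))] =
    (\int[lebesgue_measure]_(x in K @^-1` A) (p x)%:E)%E.
  by move=> Vp mA; rewrite -phi_densityE -Vp//; exact: mpreK.
split=> [[V Vp TV] A mA|TA]; first by rewrite TV// PV.
by have [V Vp] := exists_phi_density; exists V => // A mA; rewrite TA// PV.
Qed.

Lemma is_phi_above (T : randvar R) s : is_phi X T -> 1 <= s ->
  Pr T `[s, +oo[%classic =
  (\int[leb]_(y in `]s, +oo[) ((y - 1) * expR (- y) * (H y - H s))%:E)%E.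
Proof. by move=> /is_phiP XT s1; rewrite XT// mass_ge1. Qed.

Lemma is_phi_below (T : randvar R) s : is_phi X T -> 0 < s -> s <= 1 ->
  Pr T `]0, s[%classic =
  (\int[leb]_(y in `]0%R, s[) ((1 - y) * expR (- y) * (H s - H y))%:E)%E.
Proof. by move=> /is_phiP XT s0 s1; rewrite XT// mass_lt1. Qed.

Lemma exists_phi : exists2 T : randvar R, in_T T & is_phi X T.
Proof.
have [V Vp] := exists_phi_density.
have mKV : measurable_fun setT (K \o rv_fun V).
  have mK : measurable_fun [set: R] (K : R -> R) := measurable_L_df.
  exact: (measurableT_comp mK).
pose KV : {RV (rv_prob V) >-> R} := HB.pack (K \o rv_fun V)
  (isMeasurableFun.Build _ _ _ _ (K \o rv_fun V) mKV).
pose T := Randvar KV.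
have VT : is_phi X T by exists V.
exists T => //; split.
  rewrite (is_phiP T).1// -integral_phi_weight [LHS]integral_mkcond.
  apply: eq_integral => x _; rewrite patchE.
  case: ifPn => // /negP; rewrite inE/= in_itv/= andbT => K0.
  by have [->|/phi_weight_neq0] := eqVneq (p x) 0.
move=> n; apply/integrableP; split.
  by apply/measurable_EFinP; apply: measurable_funX; exact: mKV.
have := integral_phi_weight_moment n.
have <- : (\int[rv_prob V]_w (K (rv_fun V w) ^+ n)%:E = \int[leb]_x (p x * K x ^+ n)%:E)%E.
  apply: (@integral_has_density _ _ p (fun x => K x ^+ n)).
  - by rewrite -phi_densityE.
  - exact: measurable_phi_weight.
  - exact: phi_weight_ge0.
  - by apply: measurable_funX; exact: measurable_L_df.
  - by move=> x; rewrite exprn_ge0 ?L_df_ge0.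
apply: le_lt_trans; rewrite le_eqVlt; apply/orP; left; apply/eqP.
by apply: eq_integral => w _ /=; rewrite ger0_norm// exprn_ge0 ?L_df_ge0.
Qed.

End phi_of_H0.

(** * The function H_0 attached to a positive variable with all moments *)

Section phi'_of_T.
Context (R : realType) (T : randvar R).
Hypothesis TT : in_T T.

Let mu : probability R R := distribution (rv_prob T) (rv_fun T).
(** The indicator keeps [g] nonnegative without changing the law of [T]. *)
Let p (t : R) : R := (0 < t)%R%:R.
Let g t := p t * (expR t / t).
Let H c := phi'_fun T c.

Let mid : measurable_fun [set: R] (@id R) := @measurable_id _ _ setT.

Let mp : measurable_fun [set: R] p.
Proof.
rewrite (_ : p = \1_(`]0, +oo[%classic : set R)); first exact: measurable_indic.
by apply/funext => t; rewrite indicE /p mem_setE in_itv/= andbT.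
Qed.

Let p_ge0 t : 0 <= p t. Proof. exact: ler0n. Qed.

Let p_neq0 t : p t != 0 -> 0 < t.
Proof. by rewrite /p; case: (0 < t) => //; rewrite eqxx. Qed.

Let p1 t : 0 < t -> p t = 1. Proof. by rewrite /p => ->. Qed.

Lemma Pr_positive_part (A : set R) : measurable A ->
  Pr T A = (\int[mu]_(t in id @^-1` A) (p t)%:E)%E.
Proof.
move=> mA; rewrite preimage_id; pose B : set R := `]0, +oo[%classic.
have mB : measurable B by exact: measurable_itv.
have -> : p = \1_B.
  by apply/funext => t; rewrite indicE /p mem_setE in_itv/= andbT.
rewrite integral_indic// setIC -[LHS]/(mu A) (measureDI mu mA mB).
rewrite -[RHS]add0e; congr (_ + _)%E.
apply/eqP; rewrite eq_le measure_ge0 andbT.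
have <- : mu (~` B) = 0%E.
  by rewrite probability_setC//; case: TT; rewrite -[Pr _ _]/(mu B) => -> _; rewrite subee.
by apply: le_measure; rewrite ?inE//; [exact: measurableD|exact: measurableC].
Qed.

Lemma T_increments c : pushes_to_increments mu id g (H c).
Proof. exact: (phi'_increments mid mp p_ge0 Pr_positive_part c). Qed.

Lemma phi'_fun_above c s : 1 <= s -> Pr T `[s, +oo[%classic =
  (\int[leb]_(y in `]s, +oo[) ((y - 1) * expR (- y) * (H c y - H c s))%:E)%E.
Proof.
move=> s1; rewrite Pr_positive_part//.
exact: (mass_above mid mp p_ge0 p_neq0 (T_increments c) s1).
Qed.

Lemma phi'_fun_below c s : 0 < s -> s <= 1 -> Pr T `]0, s[%classic =
  (\int[leb]_(y in `]0%R, s[) ((1 - y) * expR (- y) * (H c s - H c y))%:E)%E.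
Proof.
move=> s0 s1; rewrite Pr_positive_part//.
exact: (mass_below mid mp p_ge0 p_neq0 (T_increments c) s0 s1).
Qed.

Lemma phi'_fun_nd c : {in `]0, +oo[ &, nondecreasing_fun (H c)}.
Proof.
move=> a b; rewrite !in_itv/= !andbT => a0 _ ab.
rewrite -subr_ge0 -lee_fin -T_increments//; apply: integral_ge0 => t _.
by rewrite lee_fin (tilt_ge0 p_ge0).
Qed.

Let H_le c a b : 0 < a -> a <= b -> H c a <= H c b.
Proof.
move=> a0 ab; apply: phi'_fun_nd; rewrite ?in_itv/= ?andbT//.
exact: lt_le_trans ab.
Qed.

(** [`]-oo, y[] is the increasing union of the [`]-oo, y - 1/(n+1)[]. *)
Let df_left_lc (y e : R) : 0 < e ->
  exists2 z, z < y & forall x, z < x -> x <= y -> df_left T y - df_left T x <= e.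
Proof.
move=> e0; pose F (n : nat) := (`]-oo, (y - n.+1%:R^-1)%R[%classic : set R).
have FE : \bigcup_n F n = `]-oo, y[%classic.
  apply/seteqP; split => t /=.
    by move=> [n _]; rewrite /F /= !in_itv/= => /lt_le_trans; apply; rewrite gerBl.
  rewrite in_itv/= => ty; have yt : 0 < y - t by rewrite subr_gt0.
  exists (Num.bound (y - t)^-1) => //; rewrite /F /= in_itv/= ltrBrDr -ltrBrDl.
  rewrite invf_plt ?posrE// (lt_le_trans (archi_boundP _)) ?invr_ge0 ?(ltW yt)//.
  by rewrite ler_nat.
have : mu (F n) @[n --> \oo] --> mu (\bigcup_n F n).
  apply: nondecreasing_cvg_mu.
  - by move=> n; exact: measurable_itv.
  - by rewrite FE; exact: measurable_itv.
  move=> m n mn; apply/subsetPset => t; rewrite /F /= !in_itv/= => /lt_le_trans; apply.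
  by rewrite lerD2l lerN2 lef_pV2 ?posrE// ler_nat.
rewrite FE -[mu _]/(Pr T _) -df_leftE => /fine_cvg /cvgrPdist_le /(_ _ e0)[n _ /(_ _ (leqnn n))].
rewrite /= -[fine _]/(df_left T (y - n.+1%:R^-1)) => nyn.
exists (y - n.+1%:R^-1); first by rewrite gtrBl.
move=> x zx xy; rewrite (le_trans _ nyn)// (le_trans _ (ler_norm _))//.
by rewrite lerD2l lerN2 df_left_nd// ltW.
Qed.

(** The increment over [`[x, y[] is the integral of [e^t / t] against the law of [T], and
    [e^t / t] stays below [C] on [`[y / 2, y[]. *)
Lemma phi'_fun_left_continuous c (y : R) : 0 < y -> H c x @[x --> y^'-] --> H c y.
Proof.
move=> y0; apply/cvgrPdist_le => e e0.
pose C := expR y / (y / 2).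
have C0 : 0 < C by rewrite divr_gt0 ?expR_gt0// divr_gt0.
have [z zy Pz] := df_left_lc y (divr_gt0 e0 C0).
near=> x.
have xy : x < y by near: x; exact: nbhs_left_lt.
have zx : z < x by near: x; exact: nbhs_left_gt.
have x2 : y / 2 < x by near: x; apply: nbhs_left_gt; rewrite ltr_pdivrMr// ltr_pMr// ltr1n.
have x0 : 0 < x by rewrite (lt_trans _ x2)// divr_gt0.
rewrite ger0_norm; last first.
  by rewrite subr_ge0 H_le// ltW.
rewrite -lee_fin -(T_increments c x0 (ltW xy)) preimage_id.
apply: (@le_trans _ _ (\int[mu]_(w in `[x, y[) (C * p w)%:E)%E).
  apply: ge0_le_integral => //.
  - by move=> t _; rewrite lee_fin (tilt_ge0 p_ge0).
  - by apply/measurable_EFinP/measurable_funTS; exact: (measurable_tilt mid mp).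
  - by apply/measurable_EFinP/measurable_funTS; exact: measurable_funM.
  - move=> t /=; rewrite in_itv/= => /andP[xt ty]; rewrite lee_fin /g mulrC ler_wpM2r//.
    have t0 := lt_le_trans x0 xt.
    rewrite ler_pM ?expR_ge0 ?invr_ge0 ?(ltW t0) ?ler_expR ?(ltW ty)//.
    by rewrite lef_pV2 ?posrE ?divr_gt0// ltW// (lt_le_trans x2).
under eq_integral do rewrite EFinM.
rewrite ge0_integralZl_EFin ?(ltW C0)//; last 2 first.
- by move=> t _; rewrite lee_fin.
- by apply/measurable_EFinP/measurable_funTS.
rewrite -[X in integral _ X]preimage_id -Pr_positive_part//.
rewrite Pr_itvco ?(ltW xy)//.
by rewrite lee_fin -ler_pdivlMl// mulrC; apply: Pz => //; exact: ltW.
Unshelve. all: by end_near. Qed.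

Let mH c : measurable_fun (`]0, +oo[%classic : set R) (H c).
Proof. by apply: nondecreasing_in_measurable; exact: phi'_fun_nd. Qed.

Let moment n : (\int[mu]_t `|t ^+ n|%:E < +oo)%E.
Proof.
case: TT => _ /(_ n) /integrableP[_]; apply: le_lt_trans.
rewrite /mu ge0_integral_distribution//.
by apply/measurable_EFinP; apply: measurableT_comp => //; exact: exprn_measurable.
Qed.

(** By the layer cake this is the integral of [e^t / t * upper_gamma m t] over [t >= 1]
    under the law of [T], which is at most a multiple of the moment of order [m]. *)
Let tail_finite c m :
  (\int[leb]_(y in `]1%R, +oo[) (y ^+ m * expR (- y) * (H c y - H c 1))%:E < +oo)%E.
Proof.
rewrite -(integral_tilt_gamma mid mp p_ge0 p_neq0 (T_increments c)) preimage_id.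
have [C C0 UC] := upper_gamma_le R m.
have mtm : measurable_fun [set: R] (fun t : R => `|t ^+ m|%:E).
  by apply/measurable_EFinP; apply: measurableT_comp => //; exact: exprn_measurable.
apply: (@le_lt_trans _ _ (\int[mu]_(t in `[1%R, +oo[%classic) (C%:E * `|t ^+ m|%:E))%E).
  apply: ge0_le_integral => //.
  - move=> t /=; rewrite in_itv/= andbT => t1; have t0 := le_trans ler01 t1.
    rewrite lee_fin mulr_ge0 ?(tilt_ge0 p_ge0)// (le_trans _ (upper_gamma_ge m t0))//.
    by rewrite mulr_ge0 ?expR_ge0 ?exprn_ge0.
  - apply/measurable_EFinP/measurable_funTS; apply: measurable_funM.
      exact: (measurable_tilt mid mp).
    by apply: continuous_measurable_fun; exact: continuous_upper_gamma.
  - by apply: emeasurable_funM => //; exact: measurable_funTS.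
  - move=> t /=; rewrite in_itv/= andbT => t1; have t0 := lt_le_trans ltr01 t1.
    rewrite -EFinM lee_fin (le_trans (ler_wpM2l (tilt_ge0 p_ge0 p_neq0 t) (UC t t1)))//.
    rewrite p1// mul1r expRN ger0_norm ?exprn_ge0 ?(ltW t0)//.
    have -> : expR t / t * (C * (t ^+ m / expR t)) = C * t ^+ m * t^-1.
      by field; rewrite !gt_eqF ?expR_gt0.
    by rewrite ler_piMr ?mulr_ge0 ?exprn_ge0 ?(ltW t0)// invf_le1.
rewrite ge0_integralZl_EFin//; last exact: measurable_funTS.
rewrite lte_mul_pinfty ?lee_fin//.
by apply: le_lt_trans (moment m); exact: ge0_subset_integral.
Qed.

(** By the layer cake this is the integral of [e^t] over [0 < t < 1] under the law of [T]. *)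
Let head_finite c : (\int[leb]_(y in `]0%R, 1%R[) (H c 1 - H c y)%:E < +oo)%E.
Proof.
rewrite -(integral_tilt_id mid mp p_ge0 p_neq0 (T_increments c)) preimage_id.
apply: (@le_lt_trans _ _ (\int[mu]_(t in `]0%R, 1%R[%classic) cst (expR 1)%:E t)%E).
  apply: ge0_le_integral => //.
  - move=> t /=; rewrite in_itv/= => /andP[t0 t1].
    by rewrite lee_fin mulr_ge0 ?(tilt_ge0 p_ge0)// ltW.
  - apply/measurable_EFinP/measurable_funTS; apply: measurable_funM => //.
    exact: (measurable_tilt mid mp).
  - move=> t /=; rewrite in_itv/= => /andP[t0 t1].
    by rewrite lee_fin p1// mul1r divfK ?gt_eqF// ler_expR ltW.
rewrite integral_cst//=.
rewrite lte_mul_pinfty ?lee_fin ?expR_ge0//.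
by rewrite (le_lt_trans (probability_le1 _ _))// ltry.
Qed.

Let integrable_increment_phi' c m :
  leb.-integrable `]0, +oo[ (fun y => (y ^+ m * expR (- y) * (H c y - H c 1))%:E).
Proof.
have mF : measurable_fun (`]0, +oo[%classic : set R)
    (fun y => (y ^+ m * expR (- y) * (H c y - H c 1))%:E).
  apply/measurable_EFinP; apply: measurable_funM; last exact: measurable_funB.
  apply: measurable_funTS; apply: continuous_measurable_fun.
  exact: continuous_powexp.
apply/integrableP; split => //.
have mF' (D : set R) : measurable D -> D `<=` `]0, +oo[%classic ->
    measurable_fun D (fun y => `|(y ^+ m * expR (- y) * (H c y - H c 1))%:E|%E).
  move=> mD sD; apply: (measurable_funS (measurable_itv `]0%R, +oo[) sD).
  exact: measurableT_comp.
rewrite itv0y_cut1 ge0_integral_setU//; last 2 first.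
- by rewrite -itv0y_cut1; exact: mF'.
- exact: disjoint_itv0y_cut1.
have sub1 : (`]0, 1[%classic : set R) `<=` `]0, +oo[%classic.
  by rewrite itv0y_cut1; exact: subsetUl.
have sub2 : (`[1, +oo[%classic : set R) `<=` `]0, +oo[%classic.
  by rewrite itv0y_cut1; exact: subsetUr.
apply: lte_add_pinfty.
  apply: le_lt_trans (head_finite c); apply: ge0_le_integral => //.
  - exact: mF'.
  - by apply/measurable_EFinP; apply: measurable_funB => //; exact: measurable_funS (mH c).
  - move=> y /=; rewrite in_itv/= => /andP[y0 y1].
    rewrite lee_fin normrM distrC [X in _ * X]ger0_norm; last first.
      by rewrite subr_ge0 H_le// ltW.
    rewrite ler_piMl//.
      by rewrite subr_ge0 H_le// ltW.
    rewrite ger0_norm ?mulr_ge0 ?expR_ge0 ?exprn_ge0 ?(ltW y0)//.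
    rewrite mulr_ile1 ?expR_ge0 ?exprn_ge0 ?exprn_ile1 ?(ltW y0) ?(ltW y1)//.
    by rewrite expR_le1 oppr_le0 ltW.
rewrite -integral_itv_obnd_cbnd; last first.
  by apply: mF' => // y; rewrite /= !in_itv/= !andbT; exact: lt_trans.
apply: le_lt_trans (tail_finite c m); rewrite le_eqVlt; apply/orP; left; apply/eqP.
apply: eq_integral => y; rewrite inE/= in_itv/= andbT => y1; have y0 := lt_trans ltr01 y1.
rewrite ger0_norm// !mulr_ge0 ?expR_ge0 ?exprn_ge0 ?(ltW y0)// subr_ge0.
by rewrite H_le// ltW.
Qed.

Lemma phi'_fun_integrable c m :
  leb.-integrable `]0, +oo[ (fun y => (y ^+ m * expR (- y) * phi'_fun T c y)%:E).
Proof.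
have -> : (fun y => (y ^+ m * expR (- y) * phi'_fun T c y)%:E) =
    (fun y => (y ^+ m * expR (- y) * (H c y - H c 1))%:E +
       (H c 1)%:E * (y ^+ m * expR (- y))%:E)%E.
  by apply/funext => y; rewrite -EFinM -EFinD /H; congr EFin; ring.
have iE : leb.-integrable `]0, +oo[ (fun y => (H c 1)%:E * (y ^+ m * expR (- y))%:E)%E.
  by apply: integrableZl => //; exact: integrable_powexp.
by apply: (integrableD _ (integrable_increment_phi' c m) iE).
Qed.

Lemma integrable_exp_phi'_fun c :
  leb.-integrable `]0, +oo[ (fun y => (expR (- y) * phi'_fun T c y)%:E).
Proof.
by apply: eq_integrable (phi'_fun_integrable c 0) => // y _; rewrite expr0 mul1r.
Qed.

Lemma phi'_fun_Hstar c :
  (exists x y : R, [/\ 0 < x, 0 < y & H c x != H c y]) -> Hstar_fun (H c).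
Proof.
move=> nonconst; split => //.
- exact: phi'_fun_nd.
- by move=> y y0; exact: phi'_fun_left_continuous.
- move=> m; have /integrableP[_] := phi'_fun_integrable c m.
  apply: le_lt_trans; rewrite le_eqVlt; apply/orP; left; apply/eqP.
  apply: eq_integral => y; rewrite inE/= in_itv/= andbT => y0.
  by rewrite /= normrM ger0_norm// mulr_ge0 ?expR_ge0 ?exprn_ge0// ltW.
Qed.

(** By [mean_identity] the difference of the two means is the total mass of [T]. *)
Lemma phi'_fun_mean c : phi'_centering T c ->
  (\int[leb]_(y in `]0%R, +oo[) (y * expR (- y) * phi'_fun T c y)%:E = 1)%E.
Proof.
move=> cc; have := mean_identity (phi'_fun_integrable c).
rewrite cc sube0 => <-.
rewrite -(phi'_fun_above c (lexx _)) -(phi'_fun_below c ltr01 (lexx _)); case: TT => <- _.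
by rewrite itv0y_cut1 addeC [RHS]measureU//; exact/disj_set2P/disjoint_itv0y_cut1.
Qed.

(** Were the function constant, its two means would agree, since the weights [e^-y] and
    [y e^-y] both have mass 1; but they are 0 and 1. *)
Lemma phi'_fun_H0 c : phi'_centering T c -> H0_fun (phi'_fun T c).
Proof.
move=> cc; have m1 := phi'_fun_mean cc; split => //; apply: phi'_fun_Hstar.
apply: contrapT => const.
have cH y : 0 < y -> H c y = H c 1.
  move=> y0; apply: contrapT => /eqP yn1; apply: const.
  by exists y, 1; split.
have e0 : (\int[leb]_(y in `]0%R, +oo[) (expR (- y) * phi'_fun T c y)%:E = (H c 1)%:E)%E.
  transitivity (\int[leb]_(y in `]0%R, +oo[) ((H c 1)%:E * (expR (- y))%:E))%E.
    apply: eq_integral => y; rewrite inE/= in_itv/= andbT => y0.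
    by rewrite -EFinM mulrC -(cH y).
  by rewrite integralZl ?integral_exp0y ?mule1//; exact: integrable_expN.
have e1 : (\int[leb]_(y in `]0%R, +oo[) (y * expR (- y) * phi'_fun T c y)%:E = (H c 1)%:E)%E.
  transitivity (\int[leb]_(y in `]0%R, +oo[) ((H c 1)%:E * (y * expR (- y))%:E))%E.
    apply: eq_integral => y; rewrite inE/= in_itv/= andbT => y0.
    by rewrite -EFinM mulrC -(cH y).
  by rewrite integralZl ?integral_idexp0y ?mule1//; exact: integrable_idexpN.
by have := m1; rewrite e1 -e0 cc => -[] /eqP; rewrite eq_sym oner_eq0.
Qed.

(** The mean to be annihilated is affine in [c], with slope -1. *)
Lemma phi'_centering_unique :
  exists2 c : R, phi'_centering T c & forall c', phi'_centering T c' -> c' = c.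
Proof.
have i0 := integrable_exp_phi'_fun; have ie := integrable_expN R.
pose I := (\int[leb]_(y in `]0%R, +oo[) (expR (- y) * phi'_fun T 0 y)%:E)%E.
have Ifin : I \is a fin_num by exact: integrable_fin_num.
have centerE c : (\int[leb]_(y in `]0%R, +oo[) (expR (- y) * phi'_fun T c y)%:E =
    I - c%:E)%E.
  transitivity (\int[leb]_(y in `]0%R, +oo[)
      ((expR (- y) * phi'_fun T 0 y)%:E - c%:E * (expR (- y))%:E))%E.
    by apply: eq_integral => y _; rewrite -EFinM -EFinB /phi'_fun; congr EFin; ring.
  rewrite integralB//; last exact: integrableZl.
  by rewrite integralZl// integral_exp0y mule1.
exists (fine I); first by rewrite /phi'_centering centerE fineK// subee.
move=> c; rewrite /phi'_centering centerE -(fineK Ifin) => -[] /eqP.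
by rewrite subr_eq0 => /eqP.
Qed.

End phi'_of_T.

(** * The two maps are inverse to each other *)

Section inverse_maps.
Context (R : realType).
Implicit Types (X T : randvar R).

Lemma in_T_eq_dist T T' : in_T T -> eq_dist T T' -> in_T T'.
Proof.
move=> [T1 Tm] TT'; split; first by rewrite -TT'.
move=> n; have /integrableP[_ moment] := Tm n.
have mX : measurable_fun setT (fun t : R => `|t ^+ n|%:E).
  by apply/measurable_EFinP; apply: measurableT_comp => //; exact: exprn_measurable.
apply/integrableP; split.
  by apply/measurable_EFinP; apply: measurable_funX.
apply: le_lt_trans moment; rewrite le_eqVlt; apply/orP; left; apply/eqP.
transitivity (\int[distribution (rv_prob T') (rv_fun T')]_t `|t ^+ n|%:E)%E.
  by rewrite ge0_integral_distribution.
transitivity (\int[distribution (rv_prob T) (rv_fun T)]_t `|t ^+ n|%:E)%E; last first.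
  by rewrite ge0_integral_distribution.
by apply: eq_measure_integral => A mA _; rewrite -[LHS]/(Pr T' A) -TT'.
Qed.

(** The law of the image depends on [X] through its distribution function alone, and by
    [is_phiP] this law characterizes the images of [X]. *)
Lemma is_phi_eq_dist X X' T T' : in_H0 X -> eq_dist X X' -> is_phi X T ->
  is_phi X' T' <-> eq_dist T T'.
Proof.
move=> [H HH XH] XX' XT.
have dfXX' : df X = df X' by apply/eq_dist_df.
have X'H u : 0 < u < 1 -> inv_df X' u = H (L u) by move=> u01; rewrite -XH// /inv_df dfXX'.
have weight : phi_weight X' = phi_weight X by rewrite /phi_weight dfXX'.
rewrite (is_phiP HH X'H) weight -dfXX'.
split=> [T'A A mA|TT' A mA]; first by rewrite T'A// (is_phiP HH XH T).1.
by rewrite -TT'// (is_phiP HH XH T).1.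
Qed.

(** By [phi_increments] and [phi'_increments], the same measure has both the increments of
    [H] and those of [phi'_fun T c]. The two functions thus differ by a constant, which
    is 0 because both have mean 0 against [e^-y]. *)
Lemma is_phi_is_phi' X T : in_H0 X -> in_T T -> is_phi X T -> is_phi' T X.
Proof.
move=> [H HH XH] TT XT.
have [c cc c_uniq] := phi'_centering_unique TT.
exists c; split=> // y y0; rewrite (inv_df_exp XH)//.
have incH := phi_increments HH XH.
have incT := phi'_increments (measurable_L_df X) (measurable_phi_weight X)
  (phi_weight_ge0 X) ((is_phiP HH XH T).1 XT) c.
have diff a b : 0 < a -> a <= b -> H b - phi'_fun T c b = H a - phi'_fun T c a.
  move=> a0 ab; have := incT a b a0 ab; rewrite incH// => -[].
  by move=> e; rewrite -[H b](subrK (H a)) e; ring.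
pose D := H 1 - phi'_fun T c 1.
have HD z : 0 < z -> H z = phi'_fun T c z + D.
  move=> z0; suff : H z - phi'_fun T c z = D by move=> <-; rewrite addrC subrK.
  have [z1|z1] := leP 1 z; first exact: diff.
  by apply/esym; apply: diff => //; exact: ltW.
suff D0 : D = 0 by rewrite HD// D0 addr0.
have ie := integrable_expN R; have i0 := integrable_exp_phi'_fun TT c.
have [_ H0 _] := HH.
apply: EFin_inj; rewrite -[LHS]mule1 -integral_exp0y -integralZl// -[RHS]H0.
rewrite -[LHS]add0e -cc -integralD//; last exact: integrableZl.
apply: eq_integral => z; rewrite inE/= in_itv/= andbT => z0.
by rewrite HD// -EFinM -EFinD; congr EFin; ring.
Qed.

(** [X] has some image [T']. The masses of half-lines under the laws of [T] and [T'] are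
    given by the same integrals of [H], so [T] and [T'] are identically distributed. *)
Lemma is_phi'_is_phi X T : in_H0 X -> in_T T -> is_phi' T X -> is_phi X T.
Proof.
move=> XH0 TT [c [cc _ cX]]; case: (XH0) => H HH XH.
have Hc y : 0 < y -> phi'_fun T c y = H y by move=> y0; rewrite -cX// (inv_df_exp XH).
have [T' T'T XT'] := exists_phi HH XH.
have XX : eq_dist X X by [].
apply: (is_phi_eq_dist T XH0 XX XT').2.
apply: positive_law_unique.
- by case: T'T.
- by case: TT.
- move=> s s1; rewrite (is_phi_above HH XH XT' s1) (phi'_fun_above TT c s1).
  apply: eq_integral => y; rewrite inE/= in_itv/= andbT => sy.
  by rewrite !Hc// (lt_le_trans ltr01)// (le_trans s1)// ltW.
- move=> s s0 s1; rewrite (is_phi_below HH XH XT' s0 s1) (phi'_fun_below TT c s0 s1).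
  by apply: eq_integral => y; rewrite inE/= in_itv/= => /andP[y0 _]; rewrite !Hc.
Qed.

Lemma L_exp y : L (1 - expR (- y)) = y :> R.
Proof. by rewrite /L subKr expRK opprK. Qed.

Lemma exp_L (u : R) : 0 < u < 1 -> 1 - expR (- L u) = u.
Proof. by move=> /andP[_ u1]; rewrite /L opprK lnK ?posrE ?subr_gt0// subKr. Qed.

Lemma L_gt0 (u : R) : 0 < u < 1 -> 0 < L u.
Proof.
by move=> /andP[u0 u1]; rewrite /L oppr_gt0 ln_lt0// subr_gt0 u1/= gtrDl oppr_lt0.
Qed.

Lemma L_le (u v : R) : 0 < u < 1 -> 0 < v < 1 -> u <= v -> L u <= L v.
Proof.
move=> /andP[u0 u1] /andP[v0 v1] uv.
by rewrite /L lerN2 ler_ln ?posrE ?subr_gt0// lerD2l lerN2.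
Qed.

(** [L] is an increasing bijection from ]0, 1[ onto ]0, +oo[, so [H (L u)] inherits
    monotonicity and left-continuity from [H]. *)
Lemma exists_H0 (H : R -> R) : H0_fun H ->
  exists X, forall u, 0 < u < 1 -> inv_df X u = H (L u).
Proof.
move=> [[_ H_nd H_lc _] _ _]; apply: (@exists_inv_df R (fun u => H (L u))).
  move=> u v; rewrite !in_itv/= => u01 v01 uv; apply: H_nd; last exact: L_le.
    by rewrite in_itv/= L_gt0.
  by rewrite in_itv/= L_gt0.
move=> u x u01 Hx; have Lu0 := L_gt0 u01.
rewrite leNgt; apply/negP => xH.
have /filter_ex[z [z0 zL xz]] : \forall z \near (L u)^'-, [/\ 0 < z, z < L u & x < H z].
  near=> z; split; near: z; [exact: nbhs_left_gt|exact: nbhs_left_lt|].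
  exact: (cvgr_gt _ (H_lc _ Lu0)).
have v01 : 0 < 1 - expR (- z) < u.
  rewrite subr_gt0 expR_lt1 oppr_lt0 z0 /= -[ltRHS](exp_L u01).
  by rewrite ltrD2l ltrN2 ltr_expR ltrN2.
by have := Hx _ v01; rewrite L_exp leNgt xz.
Unshelve. all: by end_near. Qed.

Lemma exists_phi' T : in_T T -> exists2 X, in_H0 X & is_phi' T X.
Proof.
move=> TT; have [c cc c_uniq] := phi'_centering_unique TT.
have HH := phi'_fun_H0 TT cc; have [X XH] := exists_H0 HH.
exists X; first by exists (phi'_fun T c).
by exists c; split => // y y0; rewrite (inv_df_exp XH).
Qed.

Lemma is_phi'_eq_dist T T' X X' : is_phi' T X -> eq_dist T T' ->
  is_phi' T' X' <-> eq_dist X X'.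
Proof.
move=> [c [cc c_uniq cX]] TT'.
have phi'TT' : phi'_fun T' = phi'_fun T.
  by rewrite /phi'_fun ((eq_dist_df T T').1 TT') (eq_dist_df_left TT').
split=> [[c' [cc' _ c'X']]|XX'].
  apply/eq_dist_inv_df => u u01; rewrite -(exp_L u01) cX ?L_gt0// c'X' ?L_gt0//.
  rewrite phi'TT' (c_uniq c')//.
  by rewrite /phi'_centering -phi'TT'.
exists c; split.
- by rewrite /phi'_centering phi'TT'.
- by move=> c'; rewrite /phi'_centering phi'TT'; exact: c_uniq.
- move=> y y0; rewrite phi'TT' -cX//; apply/esym/(eq_dist_inv_df X X').1 => //.
  by rewrite subr_gt0 expR_lt1 oppr_lt0 y0 /= gtrDl oppr_lt0 expR_gt0.
Qed.

Lemma phi_in_T X T : in_H0 X -> is_phi X T -> in_T T.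
Proof.
move=> XH0 XT; case: (XH0) => H HH XH; have [T' T'T XT'] := exists_phi HH XH.
have XX : eq_dist X X by [].
by apply: in_T_eq_dist T'T _; apply: (is_phi_eq_dist T XH0 XX XT').1.
Qed.

End inverse_maps.

Theorem theorem2p1 (R : realType) :
  [/\ is_map (@in_H0 R) (@in_T R) (@is_phi R),
      one_to_one (@in_H0 R) (@is_phi R),
      onto (@in_H0 R) (@in_T R) (@is_phi R),
      is_map (@in_T R) (@in_H0 R) (@is_phi' R)
    & mutually_inverse (@in_H0 R) (@in_T R) (@is_phi R) (@is_phi' R)].
Proof.
split.
- split; first by move=> X [H HH XH]; exact: exists_phi HH XH.
  by move=> X X' T T' XH0 XT XX'; exact: is_phi_eq_dist XH0 XX' XT.
- move=> X X' T XH0 X'H0 XT X'T; have TT := phi_in_T XH0 XT.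
  have Trefl : eq_dist T T by [].
  apply: (is_phi'_eq_dist X' (is_phi_is_phi' XH0 TT XT) Trefl).1.
  exact: is_phi_is_phi'.
- move=> T TT; have [X XH0 TX] := exists_phi' TT.
  by exists X => //; exact: is_phi'_is_phi.
- split; first exact: exists_phi'.
  by move=> T T' X X' _ TX TT'; exact: is_phi'_eq_dist TX TT'.
- by move=> X T XH0 TT; split; [exact: is_phi_is_phi'|exact: is_phi'_is_phi].
Qed.
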